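(* Let $\lambda$ be a partition of $n$ and $p$ an integer with $1\le p\le n$, and let $\mu=(p,1^{n-p})$. Then \[(n)_p\,\hat\chi^\lambda_\mu=\sum_{i\ge 2}s(p+1,i)\,c^\lambda_i(p).\]
   Context: $\chi^\lambda_\mu$ denotes the value of the irreducible character of the symmetric group $S_n$ indexed by $\lambda$ at a permutation of cycle type $\mu$, and $\hat\chi^\lambda_\mu=\chi^\lambda_\mu/\dim\lambda$ is the normalized character, $\dim\lambda=\chi^\lambda_{1^n}$. $(n)_p=n(n-1)\cdots(n-p+1)$. The Stirling numbers of the first kind are defined by $(z)_m=\sum_t s(m,t)z^t$. For a partition $\lambda$ (with $l=l(\lambda)$) and an indeterminate $x$, the quantities $c^\lambda_r(x)$, $r\ge0$, are defined by the expansion in descending powers of $y$ \[\frac{C_\lambda(x-y+1)}{C_\lambda(x-y)}\,\frac{C_\lambda(-y)}{C_\lambda(-y+1)}=\prod_{i=1}^{l}\frac{(x-y+1+\lambda_i-i)(-y+1-i)}{(x-y+1-i)(-y+1+\lambda_i-i)}=-x\sum_{r\ge 0}c^\lambda_r(x)\,y^{-r},\] where $C_\lambda(z)=\prod_{(i,j)\in\lambda}(z+j-i)$ is the content polynomial (product over the cells of the Ferrers diagram). *)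

(* Defs.v *)
From mathcomp Require Import all_boot all_order all_fingroup all_algebra.
From mathcomp Require Import all_solvable all_field all_character.

Set Implicit Arguments.
Unset Strict Implicit.
Unset Printing Implicit Defensive.

Import GRing.Theory.
Local Open Scope ring_scope.

Definition is_partition_of (n : nat) (la : seq nat) : bool :=
  [&& sorted geq la, 0%N \notin la & sumn la == n].

Definition has_cycle_type (n : nat) (s : 'S_n) (mu : seq nat) : bool :=
  perm_eq [seq #|(X : {set 'I_n})| | X <- enum (porbits s)] mu.

Section IrreducibleCharacters.

Variable n : nat.

Definition label_stab (f : 'I_n -> nat) : {set 'S_n} :=
  [set s : 'S_n | [forall k, f (s k) == f k]].

Lemma label_stab_group_set f : group_set (label_stab f).
Proof.
apply/group_setP; split=> [|s t]; first by rewrite inE; apply/forallP=> k; rewrite perm1.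
rewrite !inE => /forallP fs /forallP ft; apply/forallP=> k.
by rewrite permM (eqP (ft _)).
Qed.
Canonical label_stab_group f := Group (label_stab_group_set f).

Lemma sign_is_class_fun (B : {set 'S_n}) :
  is_class_fun <<B>>%g [ffun s : 'S_n => (s \in <<B>>%g)%:R * (-1) ^+ odd_perm s : algC].
Proof.
apply: intro_class_fun => [s t Bs Bt | s /negPf->]; last by rewrite mul0r.
by rewrite groupJr // odd_permJ.
Qed.
Definition sign_char (B : {set 'S_n}) : 'CF(B) := Cfun 0 (sign_is_class_fun B).

(* The cells of the Ferrers diagram of [la] are numbered row by row;           *)
(* [reshape_index la k] and [reshape_offset la k] are the (0-based) row and    *)
(* column of cell [k].                                                         *)
Definition row_group (la : seq nat) : {group 'S_n} :=
  label_stab_group (fun k => reshape_index la k).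
Definition col_group (la : seq nat) : {group 'S_n} :=
  label_stab_group (fun k => reshape_offset la k).

(* For a partition [la] of [n], the trivial character of the row group and     *)
(* the sign character of the column group induce characters of 'S_n having     *)
(* exactly one irreducible constituent in common: it is the irreducible        *)
(* character indexed by [la], i.e., that of the Specht module. In particular   *)
(* [:: n] indexes the trivial character and [nseq n 1] the sign. The default   *)
(* value 0 is only used when [la] is not a partition of [n].                   *)
Definition irr_index (la : seq nat) : Iirr [set: 'S_n] :=
  odflt 0 [pick i |
    (i \in irr_constt ('Ind[[set: 'S_n]] (1 : 'CF(row_group la))))
    && (i \in irr_constt ('Ind[[set: 'S_n]] (sign_char (col_group la))))].

Definition sym_char (la : seq nat) : 'CF([set: 'S_n]) := 'chi_(irr_index la).

Definition normalized_sym_char (la : seq nat) (s : 'S_n) : algC :=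
  sym_char la s / sym_char la 1%g.

End IrreducibleCharacters.

Definition stirling1 (m t : nat) : int :=
  (\prod_(k < m) ('X - (k%:R : int)%:P))`_t.

Section ContentExpansion.

Variable F : fieldType.
Implicit Types (P Q : {poly F}) (la : seq nat) (x : F) (r : nat).

(* The coefficient of y^-r in the expansion of P(y) / Q(y) in descending       *)
(* powers of y: it is the constant term of the polynomial part of y^r P / Q.   *)
Definition coef_desc P Q r : F := ((P * 'X^r) %/ Q)`_0.

Lemma coef_descP P Q : Q != 0 -> (size P <= size Q)%N -> forall r,
  (size (P * 'X^r - Q * \sum_(k < r.+1) coef_desc P Q k *: 'X^(r - k))%R < size Q)%N.
Proof.
move=> Q0 sPQ r.
suff <- : (P * 'X^r) %/ Q = \sum_(k < r.+1) coef_desc P Q k *: 'X^(r - k).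
  rewrite {1}(divp_eq (P * 'X^r) Q) [Q * _]mulrC addrC addKr.
  by rewrite ltn_modp.
have sQ : (0 < size Q)%N by rewrite size_poly_gt0.
elim: r => [|r IHr].
  rewrite big_ord1 subnn expr0 alg_polyC; apply: size1_polyC.
  by rewrite size_divp // mulr1 leq_subLR addn1 prednK.
rewrite big_ord_recr /= subnn expr0 alg_polyC.
have -> : \sum_(i < r.+1) coef_desc P Q i *: 'X^(r.+1 - i)
        = ((P * 'X^r) %/ Q) * 'X.
  rewrite IHr mulr_suml; apply: eq_bigr => i _.
  by rewrite subSn ?exprSr ?scalerAl // -ltnS.
have qE : (P * 'X^(r.+1)) %/ Q
    = ((P * 'X^r) %/ Q) * 'X + (((P * 'X^r) %% Q) * 'X) %/ Q.
  rewrite exprSr mulrA {1}(divp_eq (P * 'X^r) Q) mulrDl mulrAC.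
  by rewrite divpD mulpK.
have sm : (size ((((P * 'X^r) %% Q) * 'X) %/ Q)%R <= 1)%N.
  rewrite size_divp // leq_subLR addn1 prednK //.
  by rewrite (leq_trans (size_polyMleq _ _)) // size_polyX addn2 ltn_modp.
rewrite /coef_desc qE coefD coefMX /= add0r.
by rewrite -(size1_polyC sm).
Qed.

Definition content_poly la : {poly F} :=
  \prod_(i < size la) \prod_(j < nth 0%N la i) ('X + (j%:R - i%:R)%:P).

(* Numerator and denominator, as polynomials in 'X = y, of                     *)
(* C_la(x - y + 1) C_la(- y) / (C_la(x - y) C_la(- y + 1)).                    *)
Definition ratio_num la x : {poly F} :=
  (content_poly la \Po (x%:P - 'X + 1)) * (content_poly la \Po (- 'X)).
Definition ratio_den la x : {poly F} :=
  (content_poly la \Po (x%:P - 'X)) * (content_poly la \Po (- 'X + 1)).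

(* c^la_r(x), for x != 0: the indeterminate x is an arbitrary element of an    *)
(* arbitrary field, which covers both F(x) and the substitution of a value.    *)
Definition content_coef la x r : F :=
  - x^-1 * coef_desc (ratio_num la x) (ratio_den la x) r.

Lemma size_ratio la x :
  (size (ratio_num la x) = size (ratio_den la x)) /\ ratio_den la x != 0.
Proof.
have sN : size (- 'X : {poly F}) = 2 by rewrite size_polyN size_polyX.
have sC (c : F) : size (c%:P - 'X) = 2 by rewrite -opprB size_polyN size_XsubC.
have sC1 (c : F) : size (c%:P - 'X + 1) = 2 by rewrite addrAC -polyCD sC.
have sN1 : size (- 'X + 1 : {poly F}) = 2 by rewrite addrC -polyC1 sC.
have c0 : content_poly la != 0.
  apply/prodf_neq0 => i _; apply/prodf_neq0 => j _.
  by rewrite -[_%:P]opprK -polyCN polyXsubC_eq0.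
have nz (q : {poly F}) : size q = 2 -> content_poly la \Po q != 0.
  by move=> sq; rewrite comp_poly2_eq0.
split; last by rewrite mulf_neq0 ?nz.
by rewrite !size_mul ?nz // !size_comp_poly2.
Qed.

Lemma content_coefP la x : x != 0 -> forall r,
  (size (ratio_num la x * 'X^r
         - ratio_den la x * \sum_(k < r.+1) (- x * content_coef la x k) *: 'X^(r - k))%R
     < size (ratio_den la x))%N.
Proof.
move=> x0 r; have [sE d0] := size_ratio la x.
under eq_bigr => k _ do rewrite /content_coef mulrA mulrNN divff // mul1r.
by apply: coef_descP; rewrite ?sE.
Qed.

End ContentExpansion.

(* Main.v *)
(**
The character of [la] is exhibited by the determinantal formula: with
[gamma_i = la_i + l - 1 - i], let [psi] be the alternating sum over [w] in [S_l]
of the permutation characters on the labelings of [{1..n}] in which label [i]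
occurs [gamma_i - w i] times.  The norm of [psi] counts, with signs, pairs of
permutations and matrices of natural numbers with prescribed margins; it is the
coefficient of [x^gamma] in [det (h_(gamma_i - j)) * det (x_j ^ i)], which is 1
by the Jacobi-Trudi identity [det (h_(gamma_i - j)) * det (x_j ^ i) =
det (x_j ^ gamma_i)].  So [psi] is irreducible up to sign.  Only one of its
summands, the one induced from the row group, shares a constituent with the
character induced from the sign of the column group; hence [psi] is, up to
sign, the irreducible character indexed by [la].

Counting labelings fixed by a [p]-cycle yields Frobenius' formula
[(n)_p psi(p-cycle) / psi(1) = sum_i (gamma_i)_p
  prod_(j != i) (gamma_j - gamma_i + p) / (gamma_j - gamma_i)].
On the other side, [s(p+1, i)] being the coefficients of [(y)_(p+1)], the sum in
question is [-1/p] times the coefficient of [y^0] in [(y)_(p+1) R(y)], where [R]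
is the ratio of content polynomials.  Telescoping along rows turns
[(y-1)...(y-p) R(y)] into [(u)_p prod_i (u - p - gamma_i) / (u - gamma_i)] with
[u = y + l - 1], whose residues at the points [gamma_i] are [-p] times the terms
of Frobenius' formula.
*)
Require Import Defs.
From mathcomp Require Import all_boot all_order all_fingroup all_algebra.
From mathcomp Require Import all_solvable all_field all_character.
From mathcomp Require Import mpoly zify ring.

Set Implicit Arguments.
Unset Strict Implicit.
Unset Printing Implicit Defensive.

Import Order.TTheory GRing.Theory Num.Theory.
Local Open Scope ring_scope.

(** * Labelings *)

Section Labelings.

Variables (n : nat) (T : finType).
Implicit Types (f : {ffun 'I_n -> T}) (g s : 'S_n).

Definition content f t : nat := #|[set k | f k == t]|.

Definition fixes g f : bool := [forall k, f (g k) == f k].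

Lemma count_mktuple f t : count_mem t [tuple f k | k < n] = content f t.
Proof.
rewrite /content cardE [in RHS]/enum_mem -enumT size_filter count_map.
by rewrite val_ord_tuple; apply: eq_count => k; rewrite /= inE.
Qed.

(** The inverse makes this a right action. *)
Definition relabel f s := [ffun k => f ((s^-1)%g k)].

Fact relabel_is_action : is_action [set: 'S_n] relabel.
Proof.
split=> [s f f' /ffunP eqf | f s s' _ _].
  by apply/ffunP => k; have := eqf (s k); rewrite !ffunE permK.
by apply/ffunP => k; rewrite !ffunE invMg permM.
Qed.

Canonical relabel_action := Action relabel_is_action.

Lemma relabel_fixes f s : (relabel f s == f) = fixes s f.
Proof.
apply/eqP/forallP => [/ffunP eqf k | fixf].
  by have := eqf (s k); rewrite ffunE permK => ->.
by apply/ffunP => k; rewrite ffunE -{2}[k](permKV s) (eqP (fixf _)).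
Qed.

Lemma content_relabel f s : content (relabel f s) =1 content f.
Proof.
move=> t; rewrite /content -[RHS](card_imset _ (@perm_inj _ s)); apply: eq_card => k.
rewrite !inE ffunE; apply/eqP/imsetP => [ft | [j]].
  by exists ((s^-1)%g k); rewrite ?inE ?ft // permKV.
by rewrite inE => /eqP <- ->; rewrite permK.
Qed.

Lemma eq_content_relabel f f' : content f' =1 content f -> exists s, f' = relabel f s.
Proof.
move=> eq_cont.
have /tuple_permP[s def_f] : perm_eq [tuple f' k | k < n] [tuple f k | k < n].
  by apply/allP => t _ /=; rewrite !count_mktuple eq_cont.
exists (s^-1)%g; apply/ffunP => k; rewrite ffunE invgK.
by have /val_inj/(congr1 (fun u : n.-tuple T => tnth u k)) := def_f; rewrite !tnth_mktuple.
Qed.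

Lemma orbit_relabel f :
  orbit relabel_action setT f = [set f' | [forall t, content f' t == content f t]].
Proof.
apply/setP => f'; rewrite inE; apply/imsetP/forallP => [[s _ ->] t | eqf].
  by rewrite content_relabel.
by have [|s ->] := @eq_content_relabel f f'; [move=> t; apply/eqP | exists s].
Qed.

Lemma exists_content (A : T -> nat) :
  (\sum_t A t = n)%N -> exists f, content f =1 A.
Proof.
move=> sumA; pose s := flatten [seq nseq (A t) t | t <- enum T].
have sz_s : size s == n.
  rewrite size_flatten /shape -map_comp -sumA -big_enum /= sumnE big_map.
  by apply/eqP/eq_bigr => t _; rewrite /= size_nseq.
exists [ffun k => tnth (Tuple sz_s) k] => t.
have <- : count_mem t s = A t.
  rewrite count_flatten -map_comp sumnE big_map big_enum /= (bigD1 t) //=.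
  rewrite count_nseq /= eqxx mul1n big1 ?addn0 // => u /negPf ne_ut.
  by rewrite count_nseq /= ne_ut.
rewrite -count_mktuple -[s]/(tval (Tuple sz_s)); congr count; congr tval.
by apply: eq_from_tnth => k; rewrite tnth_mktuple ffunE.
Qed.

(** Burnside's lemma: the labelings of content [A] form a single orbit. *)
Lemma sum_fixes_content (A : T -> nat) : (\sum_t A t = n)%N ->
  (\sum_(g : 'S_n) #|[set f | fixes g f & [forall t, content f t == A t]]| = n`!)%N.
Proof.
move=> /exists_content[f contf].
pose S := [set f' | [forall t, content f' t == content f t]].
have Sf : S = orbit relabel_action setT f by rewrite orbit_relabel.
have := @Frobenius_Cauchy _ _ _ relabel_action [set: 'S_n] S.
have -> : orbit relabel_action setT @: S = [set S].
  rewrite Sf; apply/setP => X; rewrite inE; apply/imsetP/eqP => [[f' f'f ->] | ->].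
    by apply/orbit_eqP.
  by exists f; rewrite ?orbit_refl.
rewrite cards1 mul1n cardsT card_Sn => <-; last by rewrite Sf acts_orbit ?subsetT.
rewrite [RHS]big_mkcond /=; apply: eq_bigr => g _; rewrite inE; apply: eq_card => f'.
rewrite !inE sub1set inE /= relabel_fixes andbC; congr (_ && _).
by apply: eq_forallb => t; rewrite contf.
Qed.

(** [H] is the stabilizer of [f], so the induced character is the permutation character on the orbit
    of [f]. *)
Lemma cfInd1_content (H : {group 'S_n}) f x :
    (forall s, (s \in H) = fixes s f) ->
  'Ind[[set: 'S_n]] (1 : 'CF(H)) x
    = #|[set f' | fixes x f' & [forall t, content f' t == content f t]]|%:R.
Proof.
move=> defH; rewrite cfIndE ?subsetT // (reindex_inj invg_inj) /=.
pose F f' : algC := (fixes x f')%:R.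
transitivity (#|H|%:R^-1 * \sum_(y : 'S_n) F (relabel f y)).
  congr (_ * _); apply: eq_big => [y | y _]; first by rewrite !inE.
  rewrite cfun1E defH /F; congr (_%:R); congr nat_of_bool.
  apply/forallP/forallP => H' k.
    by have := H' ((y^-1)%g k); rewrite !ffunE conjgE !permM invgK permKV.
  by have := H' (y k); rewrite !ffunE conjgE !permM invgK permK.
(* The fibres of [relabel f] over the orbit are cosets of [H]; their common size cancels the leading
   factor. *)
rewrite (partition_big (relabel f) (mem (orbit relabel_action setT f))) /=; last first.
  by move=> y _; apply: mem_orbit; rewrite inE.
rewrite (eq_bigr (fun f' => F f' * #|H|%:R)); last first.
  move=> f' /imsetP[y _ ->]; rewrite (eq_bigr (fun=> F (relabel f y))); last first.
    by move=> z /eqP ->.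
  rewrite big_const iter_addr_0 mulr_natr; congr (_ *+ _).
  have := amove_act relabel_action f (subxx [set: 'S_n]) (in_setT y).
  move/(congr1 (fun X : {set 'S_n} => #|X|)); rewrite card_rcoset => cardE.
  transitivity #|[set z | relabel f z == relabel f y]|.
    by rewrite cardsE; apply: eq_card.
  transitivity #|amove relabel_action [set: 'S_n] f (relabel f y)|.
    by apply: eq_card => z; rewrite !inE.
  by rewrite cardE; apply: eq_card => s; rewrite defH !inE sub1set inE /= relabel_fixes.
rewrite -mulr_suml mulrC mulfK ?neq0CG // orbit_relabel.
rewrite -sum1dep_card natr_sum /F big_mkcond [RHS]big_mkcond /=.
by apply: eq_bigr => f' _; rewrite inE; case: (fixes x f'); case: [forall t, _].
Qed.

End Labelings.

(** * The Jacobi-Trudi identity *)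

Section JacobiTrudi.

Variables (R : comNzRingType) (l N : nat).
Notation K := {mpoly R[l]}.

(** The series of [1 / (1 - a X)] cut off at degree [N], which keeps the generating functions
    polynomial. *)
Definition geom (a : K) : {poly K} := \sum_(k < N) a ^+ k *: 'X^k.

(* The coefficient of [X^m] in [hgen] is the complete homogeneous polynomial of *)
(* degree [m] only for [m < N]; [egen j] generates, up to sign, the elementary  *)
(* symmetric polynomials in the variables other than [X_j].                     *)
Definition hgen : {poly K} := \prod_(i < l) geom 'X_i.

Definition egen (j : 'I_l) : {poly K} := \prod_(i < l | i != j) (1 - 'X_i *: 'X).

Lemma geomE a : geom a * (1 - a *: 'X) = 1 - a ^+ N *: 'X^N.
Proof.
rewrite -exprZn -opprB -[RHS]opprB subrX1 mulrN mulrC; congr (- (_ * _)).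
by apply: eq_bigr => k _; rewrite exprZn.
Qed.

Lemma coef_geom a m : (m < N)%N -> (geom a)`_m = a ^+ m.
Proof.
move=> lt_mN; rewrite coef_sum (bigD1 (Ordinal lt_mN)) //= coefZ coefXn eqxx mulr1.
rewrite big1 ?addr0 // => i /negPf ne_im.
rewrite coefZ coefXn; case: eqP => [im|]; last by rewrite mulr0.
by case/eqP: ne_im; apply: val_inj.
Qed.

Lemma size_egen j : (size (egen j) <= l)%N.
Proof.
have l_gt0 : (0 < l)%N := leq_ltn_trans (leq0n j) (ltn_ord j).
rewrite (leq_trans (size_prod_leq _ _)) // leq_subLR.
apply: leq_trans (_ : (\sum_(i < l | i != j) 2).+1 <= _)%N.
  rewrite ltnS leq_sum // => i _; apply: leq_trans (size_polyD _ _) _.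
  rewrite size_poly1 geq_max /= size_polyN.
  by rewrite (leq_trans (size_scale_leq _ _)) ?size_polyX.
rewrite sum_nat_const muln2 -addnn; set c := #|_|.
have -> : l = c.+1 :> nat; last by rewrite addnS.
have := cardC (pred1 j); rewrite card1 card_ord add1n => <-.
by congr _.+1; apply: eq_card => i; rewrite !inE.
Qed.

(** Modulo [X^N], every factor of [hgen] other than the [j]-th is cancelled by [egen j]. *)
Lemma coef_hgenM j m : (m < N)%N -> (hgen * egen j)`_m = 'X_j ^+ m.
Proof.
move=> lt_mN; rewrite /hgen (bigD1 j) //= /egen -mulrA -big_split /=.
under eq_bigr => i _ do rewrite geomE.
suff [r ->] : exists r,
    \prod_(i < l | i != j) (1 - 'X_i ^+ N *: 'X^N) = 1 - r * 'X^N :> {poly K}.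
  by rewrite mulrBr mulr1 coefB mulrA coefMXn lt_mN subr0 coef_geom.
apply: (big_ind (fun p => exists r, p = 1 - r * 'X^N)); first by exists 0; rewrite mul0r subr0.
  move=> _ _ [r ->] [r' ->]; exists (r + r' - r * r' * 'X^N).
  ring.
by move=> i _; exists (('X_i ^+ N)%:P); rewrite mul_polyC.
Qed.

(** The Jacobi-Trudi matrix. As [g i - k] is truncated, the test enforces the value 0 at negative
    indices. *)
Definition hmatrix (g : 'I_l -> nat) : 'M[K]_l :=
  \matrix_(i, k) if (k <= g i)%N then hgen`_(g i - k) else 0.

(** This is [coef_hgenM] written as a convolution; the sum over [k < l] is complete because [egen j]
    has degree below [l]. *)
Lemma hmatrixM (g : 'I_l -> nat) : (forall i, g i < N)%N ->
  hmatrix g *m \matrix_(k, j) (egen j)`_k = \matrix_(i, j) 'X_j ^+ g i.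
Proof.
move=> ltgN; apply/matrixP => i j; rewrite !mxE -(coef_hgenM j (ltgN i)) coefMr.
under eq_bigr => k _ do rewrite !mxE.
rewrite (big_ord_widen (maxn l (g i).+1)
  (fun k => (if (k <= g i)%N then hgen`_(g i - k) else 0) * (egen j)`_k)) ?leq_maxl //.
rewrite (big_ord_widen (maxn l (g i).+1) (fun k => hgen`_(g i - k) * (egen j)`_k)) ?leq_maxr //.
rewrite [LHS]big_mkcond [RHS]big_mkcond; apply: eq_bigr => k _ /=; rewrite ltnS.
case: (ltnP k l) => [_|le_lk]; first by case: ifP; rewrite ?mul0r.
by rewrite [(egen j)`_k]nth_default ?mulr0 ?if_same // (leq_trans (size_egen j)).
Qed.

Lemma det_hmatrix (g : 'I_l -> nat) : (0 < N)%N -> (l <= N)%N -> (forall i, g i < N)%N ->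
  \det (hmatrix g) * \det (\matrix_(i < l, j < l) ('X_j : K) ^+ i)
    = \det (\matrix_(i, j) ('X_j : K) ^+ g i).
Proof.
move=> N_gt0 leN ltgN; rewrite -(hmatrixM ltgN) det_mulmx; congr (_ * _).
(* For the exponents [0, ..., l - 1] the left factor is unitriangular, so the matrix of the [egen]
   has the Vandermonde determinant. *)
rewrite -(hmatrixM (fun i => leq_trans (ltn_ord i) leN)) det_mulmx det_trig; last first.
  by apply/is_trig_mxP => i k lt_ik; rewrite mxE leqNgt lt_ik.
rewrite big1 ?mul1r // => i _; rewrite mxE leqnn subnn /hgen coef0_prod.
by rewrite big1 // => k _; rewrite coef_geom.
Qed.

Lemma coef_hgen m : (m < N)%N ->
  hgen`_m = \sum_(c : {ffun 'I_l -> 'I_N} | (\sum_i c i)%N == m) 'X_[[multinom c i | i < l]].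
Proof.
move=> lt_mN; rewrite /hgen /geom bigA_distr_bigA coef_sum [RHS]big_mkcond /=.
apply: eq_bigr => c _.
have -> : \prod_(i < l) ('X_i ^+ c i *: 'X^(c i)) =
    (\prod_(i < l) ('X_i : K) ^+ c i) *: 'X^(\sum_i c i)%N.
  by rewrite scaler_prod prodrXr.
rewrite coefZ coefXn eq_sym mpolyXE_id; case: eqP => _; rewrite ?mulr0 // mulr1.
by apply: eq_bigr => i _; rewrite mnmE.
Qed.

(** The Leibniz terms are, up to sign, monomials whose exponents are [g] permuted; as [g] is
    injective, only the identity yields [g] itself. *)
Lemma mcoeff_det_alternant (g : 'I_l -> nat) : injective g ->
  (\det (\matrix_(i, j) ('X_j : K) ^+ g i))@_[multinom g i | i < l] = 1.
Proof.
move=> g_inj; rewrite raddf_sum /= (bigD1 1%g) //= [X in _ + X]big1 ?addr0.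
  rewrite odd_perm1 mul1r; under eq_bigr => i _ do rewrite mxE perm1.
  under eq_bigr => i _ do rewrite -[g i](mnmE g).
  by rewrite -mpolyXE_id mcoeffX eqxx.
move=> w ne_w1.
have -> : \prod_(i < l) (\matrix_(i, j) ('X_j : K) ^+ g i) i (w i)
     = 'X_[[multinom g (w^-1 i)%g | i < l]].
  rewrite mpolyXE_id [RHS](reindex_inj (@perm_inj _ w)) /=.
  by apply: eq_bigr => i _; rewrite mxE mnmE permK.
rewrite -signr_odd mulr_sign; case: ifP => _; rewrite ?mcoeffN mcoeffX;
  (case: eqP => [/mnmP eqg | _]; last by rewrite ?oppr0);
  case/eqP: ne_w1; apply/permP => i; have := eqg (w i);
  by rewrite !mnmE permK perm1 => /g_inj.
Qed.

(** Compares coefficients in [det_hmatrix]. [v] runs over the terms of the Jacobi-Trudi determinant,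
    with [A j] the exponent vector taken from the entry of index [g j - v j]; [w] runs over the
    terms of the Vandermonde determinant. *)
Lemma signed_matrix_count (g : 'I_l -> nat) : injective g ->
    (0 < N)%N -> (l <= N)%N -> (forall i, g i < N)%N ->
  \sum_(w : 'S_l) \sum_(v : 'S_l) (-1) ^+ w * (-1) ^+ v *
    #|[set A : {ffun 'I_l -> {ffun 'I_l -> 'I_N}} |
        [forall i, \sum_j A j i + w i == g i]%N &&
        [forall j, \sum_i A j i + v j == g j]%N]|%:R = 1 :> R.
Proof.
move=> g_inj N_gt0 leN ltgN; rewrite -[RHS](mcoeff_det_alternant g_inj).
(* After transposition the term of [w] gives the [i]-th variable the exponent [w i]. *)
rewrite -det_hmatrix // mulrC -[X in X * _]det_tr /determinant.
rewrite big_distrlr raddf_sum /=; apply: eq_bigr => w _.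
rewrite raddf_sum /=; apply: eq_bigr => v _.
rewrite mulrACA.
have -> : (-1) ^+ w * (-1) ^+ v = ((-1) ^+ w * (-1) ^+ v)%:MP_[l] :> K.
  by rewrite rmorphM !rmorph_sign.
rewrite mcoeffCM; congr (_ * _).
have -> : \prod_(i < l) hmatrix g i (v i) =
  \sum_(A : {ffun 'I_l -> {ffun 'I_l -> 'I_N}} | [forall j, \sum_i A j i + v j == g j]%N)
     'X_[[multinom \sum_j A j i | i < l]].
  under eq_bigr => j _.
    have -> : hmatrix g j (v j) =
        \sum_(c : {ffun 'I_l -> 'I_N} | (\sum_i c i + v j == g j)%N)
          'X_[[multinom c i | i < l]].
      rewrite mxE; case: leqP => [le_vg | lt_gv].
        rewrite coef_hgen; last by rewrite (leq_ltn_trans (leq_subr _ _)).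
        by apply: eq_bigl => c; rewrite -[in RHS](subnK le_vg) eqn_add2r.
      by rewrite big1 // => c /eqP eq_g; rewrite -eq_g ltnNge leq_addl in lt_gv.
    over.
  rewrite bigA_distr_big_dep /=; apply: eq_big => [A | A _].
    by apply/familyP/forallP => H j; have := H j.
  rewrite mprodXE; congr 'X_[_]; apply/mnmP => i; rewrite mnm_sumE mnmE.
  by apply: eq_bigr => j _; rewrite mnmE.
have -> : \prod_i (\matrix_(i < l, j < l) ('X_j : K) ^+ i)^T i (w i) = 'X_[[multinom w i : nat | i < l]].
  by rewrite mpolyXE_id; apply: eq_bigr => i _; rewrite !mxE mnmE.
rewrite mulr_sumr raddf_sum /= -sum1dep_card natr_sum.
rewrite [LHS]big_mkcond [RHS]big_mkcond; apply: eq_bigr => A _ /=.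
have -> : [forall i, \sum_j A j i + w i == g i]%N =
  (([multinom w i : nat | i < l] + [multinom \sum_j A j i | i < l])%MM == [multinom g i | i < l]).
  apply/forallP/eqP => [H | /mnmP H i]; last first.
    by have := H i; rewrite mnmDE !mnmE addnC => ->.
  by apply/mnmP => i; rewrite mnmDE !mnmE addnC (eqP (H i)).
by case: [forall j, _]; rewrite ?andbF ?andbT // -mpolyXD mcoeffX; case: eqP.
Qed.

End JacobiTrudi.

(** * The alternating sum of permutation characters *)

Section AlternatingSum.

Variables (n l : nat) (g : 'I_l -> nat).
Implicit Types (f : {ffun 'I_n -> 'I_l}) (w v : 'S_l) (x : 'S_n).

(** The additive form excludes [w i > g i], which truncated subtraction would not. *)
Definition has_weight w f : bool := [forall i, content f i + w i == g i]%N.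

(** By [young_charE] the value does not depend on the labeling picked; the default 0 matches the
    zero entries of the Jacobi-Trudi matrix. *)
Definition young_char w : 'CF([set: 'S_n]) :=
  if [pick f | has_weight w f] is Some f
  then 'Ind[[set: 'S_n]] (1 : 'CF(label_stab_group (fun k => f k : nat)))
  else 0.

Definition alternating_char : 'CF([set: 'S_n]) :=
  \sum_(w : 'S_l) (-1) ^+ w *: young_char w.

Lemma young_char_char w : young_char w \is a character.
Proof.
by rewrite /young_char; case: pickP => [f _|_]; rewrite ?cfInd_char ?cfun1_char ?cfun0_char.
Qed.

Lemma alternating_char_vchar : (alternating_char \in 'Z[irr [set: 'S_n]])%g.
Proof.
by apply: rpred_sum => w _; rewrite rpredZsign char_vchar ?young_char_char.
Qed.

Lemma young_charE w x :
  young_char w x = #|[set f | fixes x f & has_weight w f]|%:R.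
Proof.
rewrite /young_char; case: pickP => [f wt_f | no_f]; last first.
  by rewrite cfunE (_ : [set f | _ & _] = set0) ?cards0 //; apply/setP=> f; rewrite !inE no_f andbF.
rewrite (@cfInd1_content _ _ _ f); last by move=> s; rewrite inE.
congr (_%:R); apply: eq_card => f'; rewrite !inE; congr (_ && _).
apply: eq_forallb => i; have /forallP/(_ i)/eqP <- := wt_f.
by rewrite eqn_add2r.
Qed.

Lemma alternating_charE x : alternating_char x =
  \sum_(w : 'S_l) (-1) ^+ w * #|[set f | fixes x f & has_weight w f]|%:R.
Proof.
by rewrite /alternating_char sum_cfunE; apply: eq_bigr => w _; rewrite cfunE young_charE.
Qed.

Hypothesis sum_g : (\sum_i g i = n + \sum_(i < l) i)%N.

(** A pair of labelings is a labeling by pairs, and its content is a matrix with the prescribed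
    margins. Burnside's lemma gives [n!] for each matrix, which cancels the order of the group. [M]
    bounds the entries, so that the matrices form a finite type. *)
Lemma cfdot_young_char w v M : (n <= M)%N ->
  '[young_char w, young_char v] =
    #|[set A : {ffun 'I_l -> {ffun 'I_l -> 'I_M.+1}} |
        [forall i, \sum_j A j i + w i == g i]%N &&
        [forall j, \sum_i A j i + v j == g j]%N]|%:R.
Proof.
move=> le_nM; pose mat := {ffun 'I_l -> {ffun 'I_l -> 'I_M.+1}}; pose pair_labeling := {ffun 'I_n -> 'I_l * 'I_l}.
pose pF (F : pair_labeling) :=
  has_weight w [ffun k => (F k).1] && has_weight v [ffun k => (F k).2].
pose SA := [set A : {ffun 'I_l -> {ffun 'I_l -> 'I_M.+1}} |
        [forall i, \sum_j A j i + w i == g i]%N &&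
        [forall j, \sum_i A j i + v j == g j]%N].
have content1 (F : {ffun 'I_n -> 'I_l * 'I_l}) i :
    content [ffun k => (F k).1] i = (\sum_j content F (i, j))%N.
  rewrite /content -sum1_card (partition_big (fun k => (F k).2) predT) //=.
  apply: eq_bigr => j _; rewrite sum1dep_card; apply: eq_card => k.
  by rewrite !inE ffunE -pair_eqE.
have content2 (F : {ffun 'I_n -> 'I_l * 'I_l}) j :
    content [ffun k => (F k).2] j = (\sum_i content F (i, j))%N.
  rewrite /content -sum1_card (partition_big (fun k => (F k).1) predT) //=.
  apply: eq_bigr => i _; rewrite sum1dep_card; apply: eq_card => k.
  by rewrite !inE ffunE -pair_eqE andbC.
(* The indices are transposed to agree with [signed_matrix_count]; [inord] loses nothing because no
   label occurs more than [n] times. *)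
pose mx (F : pair_labeling) : mat :=
  [ffun j => [ffun i => inord (content F (i, j))]].
have mxE F i j : mx F j i = content F (i, j) :> nat.
  by rewrite !ffunE inordK // ltnS (leq_trans _ le_nM) // -[X in (_ <= X)%N]card_ord max_card.
have mxP F (A : mat) :
    [forall t : 'I_l * 'I_l, content F t == A t.2 t.1] = (mx F == A).
  apply/forallP/eqP => [H | <- [i j]]; last by rewrite mxE.
  by apply/ffunP => j; apply/ffunP => i; apply: val_inj; rewrite /= mxE (eqP (H (i, j))).
have pFE F : pF F = (mx F \in SA).
  rewrite inE /pF /has_weight; congr (_ && _); apply: eq_forallb => i.
    by rewrite content1; congr (_ + _ == _)%N; apply: eq_bigr => j _; rewrite mxE.
  by rewrite content2; congr (_ + _ == _)%N; apply: eq_bigr => j _; rewrite mxE.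
have nfact : (n`!)%:R != 0 :> algC by rewrite pnatr_eq0 -lt0n fact_gt0.
rewrite cfdotE cardsT card_Sn; apply: (mulfI nfact); rewrite mulVKf //.
transitivity ((\sum_(x : 'S_n) #|[set F | fixes x F & pF F]|)%N%:R : algC).
  rewrite natr_sum; apply: eq_big => [x | x _]; first by rewrite inE.
  rewrite !young_charE conjC_nat -natrM -cardsX; congr (_%:R).
  rewrite -(card_imset _ (_ : injective (fun u : {ffun 'I_n -> 'I_l} * {ffun 'I_n -> 'I_l} =>
    [ffun k => (u.1 k, u.2 k)]))).
    apply: eq_card => F; apply/imsetP/idP => [[[f1 f2]] | ].
      rewrite !inE /= => /andP[/andP[/forallP x1 w1] /andP[/forallP x2 w2]] ->.
      apply/andP; split; first by apply/forallP => k; rewrite !ffunE (eqP (x1 k)) (eqP (x2 k)).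
      apply/andP; split; [move: w1 | move: w2]; apply: etrans; congr has_weight; apply/ffunP => k;
      by rewrite !ffunE.
    rewrite inE => /andP[/forallP xF /andP[w1 w2]].
    exists ([ffun k => (F k).1], [ffun k => (F k).2]).
      rewrite !inE /= w1 w2 !andbT.
      by apply/andP; split; apply/forallP => k; rewrite !ffunE (eqP (xF k)).
    by apply/ffunP => k; rewrite !ffunE -surjective_pairing.
  move=> [f1 f2] [f3 f4] /ffunP eqf; congr (_, _); apply/ffunP => k;
  by have := eqf k; rewrite !ffunE /= => -[].
rewrite -natrM; congr (_%:R).
transitivity (\sum_(x : 'S_n) \sum_(A : mat | A \in SA)
  #|[set F | fixes x F & [forall t : 'I_l * 'I_l, content F t == A t.2 t.1]]|)%N.
  apply: eq_bigr => x _; rewrite -sum1dep_card (partition_big mx (mem SA)) /=; last first.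
    by move=> F /andP[_]; rewrite pFE.
  apply: eq_bigr => A SA_A; rewrite sum1dep_card; apply: eq_card => F.
  rewrite !inE mxP pFE -andbA; congr (_ && _).
  by case: eqP => [->|]; rewrite ?SA_A ?andbF.
rewrite exchange_big /= -[#|_|]/#|SA| mulnC -sum_nat_const; apply: eq_bigr => A.
rewrite inE => /andP[/forallP rowA _].
apply: (sum_fixes_content (A := fun t : 'I_l * 'I_l => A t.2 t.1)).
(* The entries of [A] sum to [n]: adding the values of [w] to the row sums gives the sum of [g]. *)
apply/eqP; rewrite -(eqn_add2r (\sum_(i < l) i)) -sum_g.
rewrite -(pair_bigA _ (fun i j => A j i : nat)) /=.
rewrite [X in (_ + X)%N](reindex_inj (@perm_inj _ w)) /= -big_split /=.
by apply/eqP/eq_bigr => i _; rewrite (eqP (rowA i)).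
Qed.

Lemma norm_alternating_char : injective g -> '[alternating_char] = 1.
Proof.
(* This [M] is at least [n], and the truncation order [M.+1] is at least [l] and exceeds every
   [g i]. *)
move=> g_inj; pose M := (n + l + \sum_i g i)%N.
have le_gM i : (g i <= M)%N by rewrite /M (bigD1 i) //= addnCA leq_addr.
have le_lM : (l <= M.+1)%N by rewrite leqW // /M addnAC leq_addl.
rewrite -(@signed_matrix_count algC l M.+1 g g_inj) //.
rewrite cfdot_suml; apply: eq_bigr => w _; rewrite cfdot_sumr; apply: eq_bigr => v _.
rewrite cfdotZl cfdotZr rmorph_sign mulrA (@cfdot_young_char w v M) //.
by rewrite /M -addnA leq_addr.
Qed.

End AlternatingSum.

(** * Identification of the irreducible character *)

Section SignCharacter.

Variable n : nat.

Lemma sign_mx_repr (H : {group 'S_n}) :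
  mx_repr H (fun s : 'S_n => ((-1) ^+ odd_perm s)%:M : 'M[algC]_1).
Proof.
split=> [|s t _ _]; first by rewrite odd_perm1.
by rewrite odd_permM signr_addb -scalar_mxM.
Qed.

Lemma sign_char_char (H : {group 'S_n}) : sign_char H \is a character.
Proof.
suff -> : sign_char H = cfRepr (MxRepresentation (sign_mx_repr H)) by apply: cfRepr_char.
apply/cfunP => s; rewrite !cfunE mxtrace_scalar mulr1n genGid.
by case: (s \in H); rewrite ?mul1r ?mul0r ?mulr1n ?mulr0n.
Qed.

(** Translation by an odd element negates the sum. *)
Lemma sum_sign_group (H : {group 'S_n}) :
  (exists2 t, t \in H & odd_perm t) -> \sum_(s in H) (-1) ^+ odd_perm s = 0 :> algC.
Proof.
case=> t Ht odd_t; set S := \sum_(s in H) _; have: S = - S.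
  rewrite {1}/S (reindex_inj (mulIg t)) -sumrN; apply: eq_big => s.
    by rewrite groupMr.
  by rewrite odd_permM odd_t signr_addb mulrN1.
by move/eqP; rewrite -addr_eq0 -mulr2n mulrn_eq0 => /eqP.
Qed.

End SignCharacter.

(** * Labelings with distinct labels in each column *)

Section ColumnStrict.

Variables (n l : nat) (g : 'I_l -> nat) (col : 'I_n -> nat).
Implicit Types (f : {ffun 'I_n -> 'I_l}) (w : 'S_l).

(** Labels in a column are distinct, but may come in any order. *)
Definition column_strict f : bool :=
  [forall k, forall k', (col k == col k') && (f k == f k') ==> (k == k')].

(** After Frobenius reciprocity, each labeling [f] contributes the sum of the signs of the column
    permutations that fix it. They form a trivial group if [f] is column strict; otherwise they
    include a transposition and the sum is 0. *)
Lemma cfdot_young_sign w :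
  '[young_char n g w, 'Ind[[set: 'S_n]] (sign_char (label_stab_group col))]
     = #|label_stab_group col|%:R^-1 * #|[set f | has_weight g w f & column_strict f]|%:R.
Proof.
rewrite -cfdot_Res_l cfdotE; congr (_ * _); set H := label_stab_group col.
transitivity (\sum_(s in H) \sum_(f : {ffun 'I_n -> 'I_l} | has_weight g w f && fixes s f) (-1) ^+ odd_perm s : algC).
  apply: eq_bigr => s Hs; rewrite cfResE ?subsetT // young_charE cfunE genGid Hs mul1r.
  rewrite rmorph_sign -sum1dep_card natr_sum mulr_suml.
  by apply: eq_big => [f | f _]; rewrite ?mul1r // andbC.
rewrite (exchange_big_dep (has_weight g w)) /=; last by move=> s f _ /andP[].
rewrite -sum1dep_card natr_sum [RHS]big_mkcondr; apply: eq_bigr => f wt_f.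
pose K : {group 'S_n} := (H :&: label_stab_group (fun k => f k : nat))%G.
transitivity (\sum_(s in K) (-1) ^+ odd_perm s : algC).
  by apply: eq_bigl => s; rewrite wt_f in_setI [s \in label_stab_group (fun k => f k)]inE.
case: ifP => [/forallP f_inj | /negbT].
  suff -> : K = 1%G by rewrite big_set1 odd_perm1.
  apply/trivGP/subsetP => s; rewrite in_setI => /andP[]; rewrite !inE => /forallP Hs /forallP fs.
  apply/eqP/permP => k; rewrite perm1; apply/eqP.
  by have /forallP/(_ k)/implyP := f_inj (s k); apply; rewrite Hs; apply: fs.
rewrite negb_forall => /existsP[k]; rewrite negb_forall => /existsP[k'].
rewrite negb_imply => /andP[/andP[/eqP eq_c /eqP eq_f] ne_kk'].
apply: sum_sign_group; exists (tperm k k'); last by rewrite odd_tperm.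
by rewrite in_setI !inE; apply/andP; split; apply/forallP => j; case: tpermP => [->|->|//];
  rewrite ?eq_c ?eq_f.
Qed.

Lemma sum_label f : (\sum_k f k = \sum_(i < l) i * content f i)%N.
Proof.
rewrite (partition_big f predT) //=; apply: eq_bigr => i _.
rewrite mulnC /content -sum_nat_const; apply: eq_big => [k | k /eqP -> //].
by rewrite inE.
Qed.

(* Both sides are compared with the number of pairs of cells in a common column. *)
Lemma column_strict_sum (row : 'I_n -> nat) f :
    (forall k k', col k = col k' -> row k = row k' -> k = k') ->
    (forall k r, (r < row k)%N -> exists2 k', col k' = col k & row k' = r) ->
  column_strict f -> (\sum_k row k <= \sum_k f k)%N.
Proof.
move=> row_inj row_ex /forallP f_inj.
(* If [h] is injective on columns, every pair of distinct cells in a column is counted exactly once,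
   so [inv h] does not depend on [h]. *)
pose inv (h : 'I_n -> nat) := (\sum_k \sum_(k' | col k' == col k) (h k' < h k))%N.
have invD (h : 'I_n -> nat) : (forall k k', col k = col k' -> h k = h k' -> k = k') ->
    (inv h + inv h = \sum_k \sum_(k' | col k' == col k) (k != k'))%N.
  move=> h_inj; rewrite {2}/inv; under [X in (_ + X)%N]eq_bigr do rewrite big_mkcond.
  rewrite exchange_big -big_split /=; apply: eq_bigr => k _.
  rewrite -big_mkcond [X in (_ + X)%N](eq_bigl (fun k' => col k' == col k)); last first.
    by move=> k'; rewrite eq_sym.
  rewrite -big_split /=; apply: eq_bigr => k' /eqP ck.
  have [<-|ne_kk'] := eqVneq k k'; first by rewrite ltnn.
  by case: ltngtP => // /h_inj -/(_ ck) eq_k; rewrite eq_k eqxx in ne_kk'.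
have f_inj' k k' : col k = col k' -> f k = f k' :> nat -> k = k'.
  move=> ck /val_inj fk; have /forallP/(_ k')/implyP := f_inj k.
  by rewrite ck fk !eqxx => /(_ isT)/eqP.
(* The column of [k] has a cell in each of the [row k] rows above [k]. *)
apply: (@leq_trans (inv row)).
  apply: leq_sum => k _; rewrite -big_mkcondr /= sum1dep_card.
  have ex r : exists k', (r < row k)%N ==> (col k' == col k) && (row k' == r).
    have [/row_ex[k' ck rk]|_] := ltnP r (row k); last by exists k.
    by exists k'; rewrite ck rk !eqxx.
  pose h (r : 'I_(row k)) := xchoose (ex r).
  have hP r : (col (h r) == col k) && (row (h r) == r :> nat).
    exact: implyP (xchooseP (ex r)) (ltn_ord r).
  rewrite -[X in (X <= _)%N]card_ord -(@card_codom _ _ h); last first.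
    move=> r r' eq_h; apply: val_inj => /=.
    by have /andP[_ /eqP <-] := hP r; have /andP[_ /eqP <-] := hP r'; rewrite eq_h.
  apply/subset_leq_card/subsetP => _ /codomP[r ->]; rewrite inE.
  by have /andP[-> /eqP ->] := hP r; rewrite ltn_ord.
have -> : inv row = inv (fun k => f k).
  by apply: double_inj; rewrite -!addnn (invD _ row_inj) (invD (fun k => f k) f_inj').
(* Labels in a column being distinct, at most [f k] of them are smaller than [f k]. *)
apply: leq_sum => k _; rewrite -big_mkcondr /= sum1dep_card.
rewrite -[X in (_ <= X)%N]card_ord.
(* [inord] needs an inhabited codomain, hence the size [(f k).+1]; the image misses [ord_max], which
   restores the bound [f k]. *)
pose h (k' : 'I_n) : 'I_(f k).+1 := inord (f k').
rewrite -(card_in_imset (f := h)) => [|k1 k2]; last first.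
  rewrite !inE => /andP[/eqP c1 lt1] /andP[/eqP c2 lt2] /(congr1 val).
  rewrite /= !inordK ?(leqW lt1) ?(leqW lt2) // => /f_inj'; apply.
  by rewrite c1.
rewrite card_ord -ltnS -[X in (_ < X)%N](card_ord (f k).+1).
rewrite -cardsT; apply/proper_card/properP; split; first exact: subsetT.
exists ord_max => //; apply/negP => /imsetP[k']; rewrite inE => /andP[_ lt_k'].
by move/(congr1 val); rewrite /= inordK ?leqW // => eq_f; rewrite -eq_f ltnn in lt_k'.
Qed.

End ColumnStrict.

(** * The irreducible character indexed by a partition *)

Section IrreducibleCharacter.

Variables (n : nat) (la : seq nat).
Hypothesis la_part : is_partition_of n la.

Notation l := (size la).
Notation g := (fun i : 'I_l => (nth 0 la i + (l - i.+1))%N).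
Notation row := (fun k : 'I_n => reshape_index la k).
Notation col := (fun k : 'I_n => reshape_offset la k).
Notation w0 := (perm (@rev_ord_inj l)).

Let sorted_la : sorted geq la. Proof. by case/and3P: la_part. Qed.
Let sumn_la : sumn la = n. Proof. by case/and3P: la_part => _ _ /eqP. Qed.

Let le_nth i j : (i <= j)%N -> (nth 0 la j <= nth 0 la i)%N.
Proof.
move=> le_ij; have [lt_j | ge_j] := ltnP j l; last by rewrite nth_default.
apply: (sorted_leq_nth (leT := geq)) => //; last by rewrite inE (leq_ltn_trans le_ij).
  by move=> x y z /= xy yz; apply: leq_trans yz xy.
by move=> x /=.
Qed.

Lemma shifted_part_inj : injective g.
Proof.
suff lt_g (i j : 'I_l) : (i < j)%N -> (g j < g i)%N.
  move=> i j eq_g; apply: val_inj => /=; case: (ltngtP i j) => // /lt_g;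
  by rewrite eq_g ltnn.
by move=> lt_ij; have := le_nth (ltnW lt_ij); have := ltn_ord j; lia.
Qed.

Lemma sum_shifted_part : (\sum_i g i = n + \sum_(i < l) i)%N.
Proof.
rewrite big_split /= [X in (_ + X)%N](reindex_inj rev_ord_inj) /=; congr (_ + _)%N.
  by rewrite -sumn_la sumnE (big_nth 0) big_mkord.
by apply: eq_bigr => i _; have := ltn_ord i; lia.
Qed.

Let row_lt (k : 'I_n) : (row k < l)%N.
Proof. by rewrite reshape_indexP // sumn_la. Qed.

Definition row_label : {ffun 'I_n -> 'I_l} := [ffun k => Ordinal (row_lt k)].

Lemma cell_eq (k k' : 'I_n) : col k = col k' -> row k = row k' -> k = k'.
Proof.
by move=> ck rk; apply: val_inj; rewrite /= -[k : nat](reshape_indexK la) ck rk reshape_indexK.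
Qed.

Lemma cell_ex r c : (c < nth 0 la r)%N -> exists2 k : 'I_n, col k = c & row k = r.
Proof.
move=> lt_c; have lt_n : (flatten_index la r c < n)%N.
  by rewrite -sumn_la flatten_indexP.
by exists (Ordinal lt_n); rewrite /= ?flatten_indexKl ?flatten_indexKr.
Qed.

Lemma col_lt (k : 'I_n) : (col k < nth 0 la (row k))%N.
Proof. by rewrite reshape_offsetP // sumn_la. Qed.

Lemma content_row_label i : content row_label i = nth 0 la i.
Proof.
have lt_n (c : 'I_(nth 0 la i)) : (flatten_index la i c < n)%N.
  by rewrite -sumn_la flatten_indexP.
pose h c := Ordinal (lt_n c).
have h_inj : injective h.
  move=> c c' /(congr1 val) /= eq_h; apply: val_inj => /=.
  by rewrite -(flatten_indexKr (ltn_ord c)) eq_h flatten_indexKr.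
rewrite -[RHS]card_ord -(card_imset _ h_inj); apply: eq_card => k.
rewrite inE -val_eqE ffunE /=; apply/eqP/imsetP => [rk | [c _ ->]]; last first.
  by rewrite /= flatten_indexKl.
have lt_c : (col k < nth 0 la i)%N by rewrite -rk col_lt.
by exists (Ordinal lt_c) => //; apply: val_inj; rewrite /= -rk reshape_indexK.
Qed.

(** The staircase [l - i.+1] added to the parts in [g] is the value of [w0] at [i]. *)
Lemma has_weight_row_label : has_weight g w0 row_label.
Proof. by apply/forallP => i; rewrite content_row_label permE. Qed.

Lemma column_strict_row_label : column_strict col row_label.
Proof.
apply/forallP => k; apply/forallP => k'; apply/implyP => /andP[/eqP ck /eqP].
by rewrite !ffunE => /(congr1 val) /= rk; apply/eqP/cell_eq.
Qed.

(* A column-strict labeling has the least possible sum when it is the row      *)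
(* index; by the rearrangement inequality only the order-reversing permutation *)
(* attains this minimum.                                                       *)
Lemma has_weight_column_strict w (f : {ffun 'I_n -> 'I_l}) :
  has_weight g w f -> column_strict col f -> w = w0.
Proof.
move=> /forallP wt_f strict_f.
have le_sum : (\sum_k row_label k <= \sum_k f k)%N.
  rewrite (@column_strict_sum _ _ col (fun k => row_label k)) // => [k k' ck|k r].
    by rewrite !ffunE; apply: cell_eq.
  rewrite ffunE /= => lt_r.
  have [|k' <- rk'] := @cell_ex r (col k); last by exists k'; rewrite ?ffunE.
  by apply: leq_trans (col_lt k) _; rewrite le_nth // ltnW.
(* The goal says that [v] is the identity. Weighting the equation content plus permutation equals
   [g] by [i], for both labelings, turns [le_sum] into the bound [le_v]. *)
pose v i := rev_ord (w i).
have v_inj : injective v by move=> i j /rev_ord_inj /perm_inj.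
have eq_w : (\sum_(i < l) i * content f i + \sum_(i < l) i * w i
   = \sum_(i < l) i * content row_label i + \sum_(i < l) i * rev_ord i)%N.
  rewrite -!big_split /=; apply: eq_bigr => i _.
  by rewrite -!mulnDr (eqP (wt_f i)) content_row_label.
have eq_v : (\sum_(i < l) i * w i + \sum_(i < l) i * v i
     = \sum_(i < l) i * rev_ord i + \sum_(i < l) i * i)%N.
  rewrite -!big_split /=; apply: eq_bigr => i _.
  by rewrite -!mulnDr; congr (_ * _)%N; have := ltn_ord i; have := ltn_ord (w i); lia.
have le_v : (\sum_(i < l) i * i <= \sum_(i < l) i * v i)%N.
  by move: le_sum eq_w eq_v; rewrite !sum_label; lia.
have sum_sq : (\sum_(i < l) (i ^ 2 + v i ^ 2) = 2 * \sum_(i < l) i * i)%N.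
  rewrite big_split /= mul2n -addnn [X in (_ + _ = X + _)%N](eq_bigr (fun i : 'I_l => i ^ 2)%N) //.
  congr (_ + _)%N; rewrite [RHS](reindex_inj v_inj) /=; exact: eq_bigr.
(* Each term satisfies [2 i v_i <= i^2 + v_i^2]; equality of the sums forces [i = v_i]
   throughout. *)
have [_] := leqif_sum (fun (i : 'I_l) (_ : true) => nat_Cauchy i (v i)).
rewrite sum_sq -big_distrr eqn_pmul2l // eqn_leq le_v andbT.
have -> : (\sum_(i < l) i * v i <= \sum_(i < l) i * i)%N.
  rewrite -(leq_pmul2l (ltn0Sn 1)) -sum_sq big_distrr leq_sum // => i _.
  by have [] := nat_Cauchy i (v i).
move=> /esym/forallP eq_iv; apply/permP => i; rewrite permE; apply: rev_ord_inj.
by rewrite rev_ordK; apply/eqP; rewrite eq_sym; apply: eq_iv.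
Qed.

Let sgn_ind := 'Ind[[set: 'S_n]] (sign_char (col_group n la)).

Let sgn_ind_char : sgn_ind \is a character.
Proof. by rewrite cfInd_char ?sign_char_char. Qed.

Lemma cfdot_young_sgn_ind w : w != w0 -> '[young_char n g w, sgn_ind] = 0.
Proof.
move=> ne_w; rewrite cfdot_young_sign (_ : [set f | _ & _] = set0) ?cards0 ?mulr0 //.
apply/setP => f; rewrite !inE; apply: contraNF ne_w => /andP[wt_f strict_f].
by apply/eqP; apply: has_weight_column_strict strict_f.
Qed.

Lemma young_char_row : young_char n g w0 = 'Ind[[set: 'S_n]] (1 : 'CF(row_group n la)).
Proof.
apply/cfunP => s; rewrite young_charE (@cfInd1_content _ _ _ row_label); last first.
  by move=> t; rewrite inE; apply: eq_forallb => k; rewrite !ffunE.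
congr (_%:R); apply: eq_card => f; rewrite !inE; congr (_ && _).
apply: eq_forallb => i; rewrite content_row_label permE.
by rewrite /= eqn_add2r.
Qed.

(** The default of [irr_index] is not reached: [row_label] makes the inner product of the two
    induced characters nonzero, so they share a constituent. *)
Lemma irr_index_constt :
  (irr_index n la \in irr_constt ('Ind[[set: 'S_n]] (1 : 'CF(row_group n la))))
    && (irr_index n la \in irr_constt sgn_ind).
Proof.
rewrite /irr_index; case: pickP => [i //|no_i].
have : '[young_char n g w0, sgn_ind] != 0.
  rewrite cfdot_young_sign mulf_neq0 ?invr_eq0 ?neq0CG // pnatr_eq0 -lt0n.
  apply/card_gt0P; exists row_label.
  by rewrite inE has_weight_row_label column_strict_row_label.
rewrite cfdot_sum_irr big1 ?eqxx // => i _; apply/eqP.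
rewrite mulf_eq0 conjC_eq0 young_char_row.
by have := no_i i; rewrite /= !irr_consttE -negb_or => /negbFE.
Qed.

(** A virtual character of norm 1 is irreducible up to sign. If it were another irreducible, its
    product with the one indexed by [la] would vanish; but exactly one summand, that of [w0],
    contains the latter, the others being orthogonal to [sgn_ind]. *)
Lemma alternating_char_irr :
  exists b : bool, alternating_char n g = (-1) ^+ b *: sym_char n la.
Proof.
have [b [i def_A]] := vchar_norm1P (alternating_char_vchar n g)
  (norm_alternating_char sum_shifted_part shifted_part_inj).
exists b; rewrite def_A /sym_char; congr (_ *: 'chi_ _); apply/eqP/negPn/negP => ne_i.
have /andP[row_j sgn_j] := irr_index_constt; set j := irr_index n la in ne_i row_j sgn_j *.
have : '[alternating_char n g, 'chi_j] = 0.
  by rewrite def_A cfdotZl cfdot_irr (negPf ne_i) mulr0.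
rewrite /alternating_char cfdot_suml (bigD1 w0) //= big1 => [|w ne_w].
  rewrite addr0 cfdotZl young_char_row => /eqP.
  by rewrite mulf_eq0 signr_eq0 /= (negPf (_ : '[_, _] != 0)).
rewrite cfdotZl; apply/eqP; rewrite mulf_eq0 signr_eq0 /=.
apply: contraT => young_j.
have := constt_ortho_char (young_char_char n g w) sgn_ind_char young_j sgn_j (cfdot_young_sgn_ind ne_w).
by move/eqP; rewrite cfnorm_irr oner_eq0.
Qed.

Lemma normalized_sym_charE s : normalized_sym_char la s =
  alternating_char n g s / alternating_char n g 1%g.
Proof.
have [b ->] := alternating_char_irr.
by rewrite /normalized_sym_char !cfunE -mulf_div divff ?mul1r // signr_eq0.
Qed.


End IrreducibleCharacter.

(** * Frobenius' formula *)

Section CountLabelings.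

Variables (I T : finType) (t0 : T).
Implicit Types (B : {set I}) (f : {ffun I -> T}) (a : T -> nat).

(** Fixing the value [t0] outside [B] lets one finite type serve all [B], each labeling of [B] being
    counted once. *)
Definition partial_labelings B a : {set {ffun I -> T}} :=
  [set f : {ffun I -> T} | [forall k, (k \notin B) ==> (f k == t0)] &
                            [forall t, #|[set k in B | f k == t]| == a t]].

Lemma partial_labelingsP B a f :
  reflect ((forall k, k \notin B -> f k = t0) /\
           (forall t, #|[set k in B | f k == t]| = a t)) (f \in partial_labelings B a).
Proof.
rewrite inE; apply: (iffP andP) => [[/forallP f0 /forallP cf]|[f0 cf]].
  by split=> [k nBk|t]; apply/eqP; [apply: implyP (f0 k) nBk | apply: cf].
by split; apply/forallP => x; [apply/implyP => /f0 -> | rewrite cf].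
Qed.

Lemma card_partial_labelings_val B b t a : b \in B -> (0 < a t)%N ->
  #|[set f in partial_labelings B a | f b == t]|
    = #|partial_labelings (B :\ b) (fun u => a u - (u == t))%N|.
Proof.
move=> Bb at_gt0; pose ext (f : {ffun I -> T}) := [ffun k => if k == b then t else f k].
have content_ext f u :
    #|[set k in B | ext f k == u]| = ((u == t) + #|[set k in B :\ b | f k == u]|)%N.
  rewrite (cardsD1 b) !inE Bb ffunE eqxx /= eq_sym; congr (_ + _)%N.
  apply: eq_card => k; rewrite !inE ffunE.
  by case: eqVneq.
rewrite -[RHS](@card_in_imset _ _ ext) => [|f f']; last first.
  move=> /partial_labelingsP[f0 _] /partial_labelingsP[f'0 _] /ffunP eq_ext.
  apply/ffunP => k; have := eq_ext k; rewrite !ffunE; case: eqP => // -> _.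
  by rewrite f0 ?f'0 // !inE eqxx.
apply: eq_card => f; rewrite inE; apply/andP/imsetP => [[/partial_labelingsP[f0 cf] /eqP fb]|[f']].
  have def_f : f = ext [ffun k => if k == b then t0 else f k].
    by apply/ffunP => k; rewrite !ffunE; case: eqP => // ->.
  exists [ffun k => if k == b then t0 else f k] => //.
  apply/partial_labelingsP; split=> [k|u]; last by rewrite -cf [in RHS]def_f content_ext addKn.
  by rewrite !inE negb_and negbK ffunE; case: eqP => //= _ /f0.
move=> /partial_labelingsP[f'0 cf'] ->; rewrite ffunE eqxx; split=> //.
apply/partial_labelingsP; split=> [k nBk|u].
  rewrite ffunE; case: eqP => [kb|/eqP ne_kb]; first by rewrite kb Bb in nBk.
  by rewrite f'0 // !inE ne_kb.
by rewrite content_ext cf' subnKC //; case: eqP => // ->.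
Qed.

(** The multinomial coefficient, by induction on [B]: sort by the label [t] of one point and split
    [#|B|] as the sum of the [a t]. *)
Lemma card_partial_labelings B a : (\sum_t a t = #|B|)%N ->
  (#|partial_labelings B a| * \prod_t (a t)`! = #|B|`!)%N.
Proof.
have [m] := ubnP #|B|; elim: m => // m IHm in B a *; rewrite ltnS => le_Bm sum_a.
have [B0 | [b Bb]] := set_0Vmem B.
  move: sum_a; rewrite {}B0 cards0 => /eqP; rewrite sum_nat_eq0 => /forallP a0.
  rewrite big1 ?muln1 => [|t _]; last by rewrite (eqP (a0 t)).
  apply/eqP/cards1P; exists [ffun=> t0]; apply/setP => f; rewrite inE.
  apply/partial_labelingsP/eqP => [[f0 _]|->].
    by apply/ffunP => k; rewrite ffunE f0 ?inE.
  split=> [k _|t]; first by rewrite ffunE.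
  by apply/eqP; rewrite (eqP (a0 t)) cards_eq0; apply/eqP/setP => k; rewrite !inE.
have cardB : #|B| = #|B :\ b|.+1 by rewrite (cardsD1 b) Bb.
rewrite -sum1_card (partition_big (fun f : {ffun I -> T} => f b) predT) //= big_distrl /=.
rewrite [in RHS]cardB factS -cardB -sum_a big_distrl; apply: eq_bigr => t _.
rewrite sum1dep_card /=; have [at0 | at_gt0] := posnP (a t).
  rewrite at0 mul0n (_ : [set f | _ & _] = set0) ?cards0 //; apply/setP => f; rewrite in_set0 inE.
  apply/negP => /andP[/partial_labelingsP[_ /(_ t)]]; rewrite at0 => /cards0_eq/setP/(_ b).
  by rewrite !inE Bb /= => ->.
rewrite card_partial_labelings_val //.
have sum_a' : (\sum_u (a u - (u == t)) = #|B :\ b|)%N.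
  apply: succn_inj; rewrite -cardB -sum_a (bigD1 t) //= [RHS](bigD1 t) //= eqxx subn1 -addSn prednK //.
  by congr (_ + _)%N; apply: eq_bigr => u /negPf ->; rewrite subn0.
rewrite -(IHm _ (fun u => a u - (u == t))%N) //; last by rewrite -ltnS -cardB.
rewrite mulnCA; congr (_ * _)%N; rewrite (bigD1 t) //= [in RHS](bigD1 t) //= mulnA eqxx subn1.
rewrite -[in (a t)`!](prednK at_gt0) factS prednK //; congr (_ * _)%N.
by apply: eq_bigr => u /negPf ->; rewrite subn0.
Qed.

End CountLabelings.

(** * Vandermonde products and falling factorials *)

Section FallingVandermonde.

Variables (R : comNzRingType) (l : nat).

Definition vandermonde_prod (z : 'I_l -> R) : R :=
  \prod_(i < l) \prod_(j < l | (i < j)%N) (z j - z i).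

(** The matrix is a Vandermonde matrix times the unitriangular matrix of coefficients. *)
Lemma det_monic_eval (q : 'I_l -> {poly R}) (z : 'I_l -> R) :
    (forall j, size (q j) = j.+1) -> (forall j, q j \is monic) ->
  \det (\matrix_(i, j) (q j).[z i]) = vandermonde_prod z.
Proof.
move=> size_q monic_q.
have -> : \matrix_(i, j) (q j).[z i] = (Vandermonde l (\row_i z i))^T *m (\matrix_(j, k) (q j)`_k)^T.
  apply/matrixP => i j; rewrite !mxE (@horner_coef_wide _ l); last by rewrite size_q.
  by apply: eq_bigr => k _; rewrite !mxE mulrC.
rewrite det_mulmx !det_tr det_Vandermonde [X in _ * X]det_trig; last first.
  by apply/is_trig_mxP => i k lt_ik; rewrite mxE nth_default // size_q.
rewrite [X in _ * X]big1 ?mulr1 => [|j _]; last first.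
  by rewrite mxE; have /monicP := monic_q j; rewrite lead_coefE size_q.
by apply: eq_bigr => i _; apply: eq_bigr => j _; rewrite !mxE.
Qed.

Lemma det_ffact (z : 'I_l -> nat) :
  \det (\matrix_(i < l, j < l) ((z i) ^_ j)%:R) = vandermonde_prod (fun i => (z i)%:R).
Proof.
rewrite -(@det_monic_eval (fun j => \prod_(k < j) ('X - k%:R%:P))) => [|j|j].
- congr (\det _); apply/matrixP => i j; rewrite !mxE horner_prod ffact_prod natr_prod.
  have [le_jz | lt_zj] := leqP j (z i).
    apply: eq_bigr => k _; rewrite hornerXsubC natrB //.
    by rewrite (leq_trans (ltnW (ltn_ord k))).
  (* Truncated and ring subtraction differ here, but both products have a zero factor at
     [k = z i]. *)
  rewrite (bigD1 (Ordinal lt_zj)) //= subnn mul0r.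
  by rewrite [RHS](bigD1 (Ordinal lt_zj)) //= hornerXsubC subrr mul0r.
- by rewrite size_prod_XsubC /index_enum -enumT size_enum_ord.
- exact: monic_prod_XsubC.
Qed.

(* Changing one variable only affects the factors that contain it. *)
Lemma vandermonde_prod_update (z z' : 'I_l -> R) i : (forall j, j != i -> z' j = z j) ->
  vandermonde_prod z' * \prod_(j < l | j != i) (z j - z i)
    = vandermonde_prod z * \prod_(j < l | j != i) (z j - z' i).
Proof.
move=> eq_z.
have split_i (y : 'I_l -> R) : vandermonde_prod y
  = \prod_(b < l | (i < b)%N) (y b - y i) * (\prod_(a < l | (a < i)%N) (y i - y a)
     * \prod_(a < l | a != i) \prod_(b < l | (a < b)%N && (b != i)) (y b - y a)).
  rewrite /vandermonde_prod (bigD1 i) //=; congr (_ * _).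
  have -> : \prod_(a < l | (a < i)%N) (y i - y a)
      = \prod_(a < l | a != i) if (a < i)%N then y i - y a else 1.
    rewrite -big_mkcondr; apply: eq_bigl => a; rewrite andbC andb_idr // => lt_ai.
    by rewrite -val_eqE neq_ltn lt_ai.
  rewrite -big_split; apply: eq_bigr => a _ /=; case: ifP => [lt_ai|nlt_ai].
    by rewrite (bigD1 i).
  rewrite mul1r; apply: eq_bigl => b; case: eqP => [->|_]; first by rewrite nlt_ai.
  by rewrite andbT.
have split_c c : \prod_(j < l | j != i) (z j - c)
    = \prod_(j < l | (i < j)%N) (z j - c) * \prod_(j < l | (j < i)%N) (z j - c).
  rewrite (bigID (fun j : 'I_l => (i < j)%N)) /=; congr (_ * _); apply: eq_bigl => j;
  by rewrite -val_eqE; case: ltngtP.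
have gt_i (b : 'I_l) : (i < b)%N -> b != i by rewrite -val_eqE; case: ltngtP.
have lt_i (a : 'I_l) : (a < i)%N -> a != i by rewrite -val_eqE; case: ltngtP.
have rest_eq : \prod_(a < l | a != i) \prod_(b < l | (a < b)%N && (b != i)) (z' b - z' a)
    = \prod_(a < l | a != i) \prod_(b < l | (a < b)%N && (b != i)) (z b - z a).
  by apply: eq_bigr => a ne_a; apply: eq_bigr => b /andP[_ ne_b]; rewrite !eq_z.
rewrite !split_i !split_c rest_eq.
rewrite (eq_bigr (fun b => z b - z' i)); last by move=> b /gt_i /eq_z ->.
have E : \prod_(a < l | (a < i)%N) (z' i - z' a) * \prod_(j < l | (j < i)%N) (z j - z i)
   = \prod_(a < l | (a < i)%N) (z i - z a) * \prod_(j < l | (j < i)%N) (z j - z' i).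
  by rewrite -!big_split; apply: eq_bigr => a /lt_i /eq_z ->; rewrite /=; ring.
move: E; set p1 := \prod_(a < l | _) (z' i - _); set p2 := \prod_(j < l | _) (_ - z i).
set p3 := \prod_(a < l | _) (z i - _); set p4 := \prod_(j < l | (j < i)%N) (_ - z' i).
move=> E.
transitivity (p1 * p2 * (\prod_(b < l | (i < b)%N) (z b - z' i) * \prod_(j < l | (i < j)%N) (z j - z i)
   * \prod_(a < l | a != i) \prod_(b < l | (a < b)%N && (b != i)) (z b - z a))); first by ring.
by rewrite E; ring.
Qed.

End FallingVandermonde.

(** * Signed counts of labelings *)

Section SignedLabelings.

Variables (R : comNzRingType) (I : finType) (l : nat) (B : {set I}) (i0 : 'I_l)
  (h : 'I_l -> nat).

Definition weighted_labelings (w : 'S_l) : {set {ffun I -> 'I_l}} :=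
  [set f : {ffun I -> 'I_l} | [forall k, (k \notin B) ==> (f k == i0)] &
     [forall t, #|[set k in B | f k == t]| + w t == h t]%N].

Hypothesis sum_h : (\sum_t h t = #|B| + \sum_(t < l) t)%N.

(** A multinomial coefficient cleared of its denominators; both sides are 0 if some [w t] exceeds
    [h t]. *)
Lemma card_weighted_labelings w :
  (#|weighted_labelings w| * \prod_t (h t)`! = #|B|`! * \prod_t h t ^_ (w t))%N.
Proof.
have [/forallP le_wh | ] := boolP [forall t, w t <= h t]%N; last first.
  rewrite negb_forall => /existsP[t]; rewrite -ltnNge => lt_hw.
  rewrite [in RHS](bigD1 t) //= ffact_small // mul0n muln0.
  rewrite (_ : weighted_labelings w = set0) ?cards0 //; apply/setP => f; rewrite !inE.
  apply/negP => /andP[_ /forallP/(_ t)/eqP eq_h].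
  by rewrite -eq_h ltnNge leq_addl in lt_hw.
have -> : weighted_labelings w = partial_labelings i0 B (fun t => h t - w t)%N.
  apply/setP => f; rewrite !inE; congr (_ && _); apply: eq_forallb => t.
  by rewrite -[in LHS](subnK (le_wh t)) eqn_add2r.
rewrite -(card_partial_labelings i0 (a := fun t => h t - w t)%N); last first.
  apply/eqP; rewrite -(eqn_add2r (\sum_(t < l) t)) -sum_h.
  rewrite [X in (_ + X)%N](reindex_inj (@perm_inj _ w)) /= -big_split /=.
  by apply/eqP/eq_bigr => t _; rewrite subnK.
rewrite -mulnA; congr (_ * _)%N; rewrite -big_split /=; apply: eq_bigr => t _.
by rewrite mulnC ffact_fact.
Qed.

(** The sum over [w] becomes the Leibniz expansion of the determinant in [det_ffact]. *)
Lemma signed_weighted_labelings :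
  (\sum_(w : 'S_l) (-1) ^+ w * #|weighted_labelings w|%:R) * (\prod_t (h t)`!)%:R
    = (#|B|`!)%:R * vandermonde_prod (fun t => (h t)%:R : R).
Proof.
rewrite -det_ffact mulr_suml mulr_sumr; apply: eq_bigr => w _.
rewrite -mulrA -natrM card_weighted_labelings natrM natr_prod mulrCA.
by congr (_ * (_ * _)); apply: eq_bigr => t _; rewrite mxE.
Qed.

End SignedLabelings.

(** * Values at the identity and at a cycle *)

Section CycleValue.

Variables (n l : nat) (g : 'I_l -> nat).
Hypothesis sum_g : (\sum_i g i = n + \sum_(i < l) i)%N.

Lemma prod_fact_unit (h : 'I_l -> nat) : (\prod_t (h t)`!)%:R != 0 :> algC.
Proof. by rewrite pnatr_eq0 -lt0n prodn_gt0 // => t; apply: fact_gt0. Qed.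

Lemma alternating_char1 : (0 < l)%N -> alternating_char n g 1%g =
  (n`!)%:R * vandermonde_prod (fun t => (g t)%:R) / (\prod_t (g t)`!)%:R.
Proof.
move=> l_gt0; have := @signed_weighted_labelings algC _ l [set: 'I_n] (Ordinal l_gt0) g.
rewrite cardsT card_ord => /(_ sum_g) <-; rewrite mulfK ?prod_fact_unit //.
rewrite alternating_charE; apply: eq_bigr => w _; congr (_ * _%:R).
apply: eq_card => f; rewrite !inE.
have -> : fixes 1 f by apply/forallP => k; rewrite perm1.
have -> : [forall k, (k \notin [set: 'I_n]) ==> (f k == Ordinal l_gt0)].
  by apply/forallP => k; rewrite inE.
rewrite /has_weight /=; apply: eq_forallb => t.
rewrite (_ : [set k in [set: 'I_n] | f k == t] = [set k | f k == t]) //.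
by apply/setP => k; rewrite !inE.
Qed.

(** A fixed labeling has one value [i] on [X], which uses up [#|X|] occurrences of [i]; the rest is
    a signed count over the complement of [X]. *)
Lemma alternating_char_cycle (X : {set 'I_n}) x s : x \in X ->
    (forall f : {ffun 'I_n -> 'I_l}, fixes s f <-> {in X, forall k, f k = f x}) ->
  alternating_char n g s = \sum_i if (#|X| <= g i)%N then
     let h t := (g t - #|X| * (t == i))%N in
     ((n - #|X|)`!)%:R * vandermonde_prod (fun t => (h t)%:R) / (\prod_t (h t)`!)%:R
   else 0.
Proof.
move=> Xx fixE; rewrite alternating_charE.
pose cnt i w := #|[set f : {ffun 'I_n -> 'I_l} | [&& fixes s f, has_weight g w f & f x == i]]|.
transitivity (\sum_i \sum_(w : 'S_l) (-1) ^+ w * (cnt i w)%:R : algC).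
  rewrite exchange_big; apply: eq_bigr => w _ /=.
  rewrite -mulr_sumr -natr_sum; congr (_ * _%:R).
  rewrite -sum1_card (partition_big (fun f : {ffun 'I_n -> 'I_l} => f x) predT) //=.
  by apply: eq_bigr => i _; rewrite sum1dep_card; apply: eq_card => f; rewrite !inE andbA.
have cont_X i (f : {ffun 'I_n -> 'I_l}) t : {in X, forall k, f k = i} ->
    content f t = (#|[set k in ~: X | f k == t]| + #|X| * (t == i))%N.
  move=> fX; rewrite /content -(cardsID X [set k | f k == t]) [LHS]addnC; congr (_ + _)%N.
    by apply: eq_card => k; rewrite !inE.
  case: eqP => [->|ne_ti]; rewrite ?muln1 ?muln0.
    by apply: eq_card => k; rewrite !inE andbC; case: (boolP (k \in X)) => //= /fX ->; rewrite eqxx.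
  apply/eqP; rewrite cards_eq0; apply/eqP/setP => k; rewrite !inE andbC.
  by case: (boolP (k \in X)) => //= /fX ->; apply/eqP => /esym.
apply: eq_bigr => i _; case: leqP => [le_Xg | lt_gX].
  pose h t := (g t - #|X| * (t == i))%N; rewrite -/h /=.
  have cXE : #|~: X| = (n - #|X|)%N by rewrite cardsCs setCK card_ord.
  have hK t : (h t + #|X| * (t == i))%N = g t.
    by rewrite /h subnK //; case: eqP => [->|]; rewrite ?muln1 ?muln0.
  (* The default label outside [~: X] is [i], so these labelings are exactly those with value [i] on
     [X]. *)
  have := @signed_weighted_labelings algC _ l (~: X) i h.
  rewrite cXE => <-; last first.
    apply/eqP; rewrite -(eqn_add2r #|X|) addnAC subnK; last by rewrite -[X in (_ <= X)%N]card_ord max_card.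
    rewrite -sum_g -(eq_bigr _ (fun t _ => hK t)) big_split /= [X in (_ + _ == _ + X)%N](bigD1 i) //=.
    by rewrite eqxx muln1 [X in (_ + (_ + X))%N]big1 ?addn0 // => t /negPf ->; rewrite muln0.
  rewrite mulfK ?prod_fact_unit //; apply: eq_bigr => w _; congr (_ * _%:R).
  apply: eq_card => f; rewrite !inE; apply/and3P/andP => [[/fixE fX wt_f /eqP fx] | [fX wt_f]].
    rewrite fx in fX; split.
      by apply/forallP => k; rewrite inE negbK; apply/implyP => /fX ->.
    apply/forallP => t; have /forallP/(_ t) := wt_f; rewrite (cont_X i) // -hK.
    by rewrite addnAC eqn_add2r.
  have {}fX : {in X, forall k, f k = i}.
    by move=> k Xk; apply/eqP; apply: implyP (forallP fX k) _; rewrite inE negbK.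
  split; [|apply/forallP => t|by rewrite fX].
    by apply/fixE => k Xk; rewrite !fX.
  by rewrite (cont_X i) // -hK addnAC eqn_add2r; have /forallP := wt_f; apply.
apply: big1 => w _; rewrite /cnt (_ : [set f | _] = set0) ?cards0 ?mulr0 //.
apply/setP => f; rewrite !inE; apply/negP => /and3P[/fixE fX /forallP/(_ i) + /eqP fx].
rewrite fx in fX; rewrite (cont_X i) // eqxx muln1 => /eqP eq_g.
by move: lt_gX; rewrite -eq_g ltnNge -addnA addnCA leq_addr.
Qed.

(** [X] is an orbit of size [p]; the other orbits are singletons, so [s] fixes every point outside
    [X]. *)
Lemma cycle_type_fixes p (s : 'S_n) : has_cycle_type s (p :: nseq (n - p) 1%N) ->
  exists X : {set 'I_n}, exists2 x, x \in X & #|X| = p /\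
    forall f : {ffun 'I_n -> 'I_l}, fixes s f <-> {in X, forall k, f k = f x}.
Proof.
move=> type_s; have p_in : p \in [seq #|(X : {set 'I_n})| | X <- enum (porbits s)].
  by rewrite (perm_mem type_s) mem_head.
have /mapP[X X_in cardX] := p_in; exists X.
have /imsetP[x _ defX] : X \in porbits s by rewrite mem_enum in X_in.
exists x; first by rewrite defX porbit_id.
split=> // f; have fix_out k : k \notin X -> s k = k.
  move=> nXk; have : #|porbit s k| \in nseq (n - p) 1%N.
    have /perm_mem <- : perm_eq [seq #|(Y : {set 'I_n})| | Y <- rem X (enum (porbits s))]
        (nseq (n - p) 1%N).
      rewrite -(perm_cons p) -(permPr type_s) perm_sym cardX.
      exact: (perm_map (fun Y : {set 'I_n} => #|Y|) (perm_to_rem X_in)).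
    apply: map_f; rewrite (mem_rem_uniq _ (enum_uniq _)) inE mem_enum imset_f // andbT.
    by apply: contraNneq nXk => <-; apply: porbit_id.
  case/nseqP => /eqP/cards1P[y orb_k] _.
  have : s k \in porbit s k by have := mem_porbit s 1 k; rewrite expg1.
  by have := porbit_id s k; rewrite orb_k !inE => /eqP -> /eqP.
split=> [/forallP fix_f k | const_f].
  rewrite defX => /porbitP[i ->]; elim: i => [|i IHi]; first by rewrite perm1.
  by rewrite expgSr permM (eqP (fix_f _)).
apply/forallP => k; case: (boolP (k \in X)) => [Xk | /fix_out -> //].
rewrite (const_f _ Xk) const_f //; move: Xk; rewrite defX => /porbitP[i ->].
by rewrite -permM -expgSr mem_porbit.
Qed.

(** Frobenius' formula: passing from the identity to the cycle moves the single variable [g i] to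
    [g i - p] in the Vandermonde product, and the quotients of factorials are falling factorials. *)
Lemma cycle_ratio p (s : 'S_n) : injective g -> (0 < l)%N -> (p <= n)%N ->
    has_cycle_type s (p :: nseq (n - p) 1%N) ->
  (n ^_ p)%:R * (alternating_char n g s / alternating_char n g 1%g) =
   \sum_i (g i ^_ p)%:R * \prod_(j < l | j != i)
     (((g j)%:R - (g i)%:R + p%:R) / ((g j)%:R - (g i)%:R)).
Proof.
move=> g_inj l_gt0 le_pn /cycle_type_fixes[X [x Xx [cardX fixE]]].
rewrite alternating_char1 // (alternating_char_cycle Xx fixE) cardX.
rewrite mulr_suml mulr_sumr; apply: eq_bigr => i _.
set V := vandermonde_prod (fun t => (g t)%:R).
have V_neq0 : V != 0.
  apply/prodf_neq0 => a _; apply/prodf_neq0 => b lt_ab.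
  by rewrite subr_eq0 eqr_nat; apply: contraTneq lt_ab => /g_inj ->; rewrite ltnn.
have P_neq0 : \prod_(j < l | j != i) ((g j)%:R - (g i)%:R) != 0 :> algC.
  apply/prodf_neq0 => j ne_ji; rewrite subr_eq0 eqr_nat.
  by apply: contraNneq ne_ji => /g_inj ->.
have fact_neq0 m : (m`!)%:R != 0 :> algC by rewrite pnatr_eq0 -lt0n fact_gt0.
(* If [g i < p], both sides vanish. *)
case: leqP => [le_pg | lt_gp]; last by rewrite mul0r mulr0 ffact_small ?mul0r.
pose h t := (g t - p * (t == i))%N; rewrite -/h /=.
have factE : (\prod_t (g t)`! = g i ^_ p * \prod_t (h t)`!)%N.
  rewrite (bigD1 i) //= [in RHS](bigD1 i) //= mulnA /h eqxx muln1 ffact_fact //.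
  by congr (_ * _)%N; apply: eq_bigr => t /negPf ->; rewrite muln0 subn0.
have eq_h j : j != i -> (h j)%:R = (g j)%:R :> algC.
  by move=> /negPf ne_ji; rewrite /h ne_ji muln0 subn0.
have Vh := @vandermonde_prod_update algC l (fun t => (g t)%:R) (fun t => (h t)%:R) i eq_h.
rewrite -/V [in RHS]/h eqxx muln1 natrB // in Vh.
rewrite -(ffact_fact le_pn) factE !natrM prodf_div.
have -> : \prod_(j < l | j != i) ((g j)%:R - (g i)%:R + p%:R) =
   vandermonde_prod (fun t => (h t)%:R) * \prod_(j < l | j != i) ((g j)%:R - (g i)%:R) / V :> algC.
  rewrite Vh mulrAC mulfV // mul1r; apply: eq_bigr => j _; ring.
have := prod_fact_unit h; have := fact_neq0 (n - p)%N.
have : (n ^_ p)%:R != 0 :> algC by rewrite pnatr_eq0 -lt0n ffact_gt0.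
have : (g i ^_ p)%:R != 0 :> algC by rewrite pnatr_eq0 -lt0n ffact_gt0.
move: V_neq0 P_neq0 => *; field.
by repeat (apply/andP; split).
Qed.

End CycleValue.

(** * The expansion of the ratio of content polynomials *)

Section PartialFractions.

Variables (F : fieldType) (l : nat) (r : 'I_l -> F).
Hypothesis r_inj : injective r.

Let b : {poly F} := \prod_i ((r i)%:P - 'X).
Let b_ i : {poly F} := \prod_(j < l | j != i) ((r j)%:P - 'X).

Let size_rX i : size ((r i)%:P - 'X) = 2.
Proof. by rewrite -opprB size_polyN size_XsubC. Qed.

Let size_b : size b = l.+1.
Proof.
rewrite size_prod => [|i _]; last by rewrite -size_poly_gt0 size_rX.
by rewrite (eq_bigr (fun=> 2)) // sum_nat_const card_ord; lia.
Qed.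

Let size_b_ i : (size (b_ i) < size b)%N.
Proof.
have b_E : b = ((r i)%:P - 'X) * b_ i by rewrite /b (bigD1 i).
have b_neq0 : b_ i != 0 by apply/prodf_neq0 => j _; rewrite -size_poly_gt0 size_rX.
by rewrite b_E size_mul ?size_rX // -size_poly_gt0 size_rX.
Qed.

(** Partial fractions: [w / b = k + sum_i c_i / (r_i - X)] and
    [X / (r_i - X) = -1 + r_i / (r_i - X)], so the polynomial part of [X w / b] is
    [X k - sum_i c_i]. *)
Lemma coef0_divp_split (w : {poly F}) :
  (('X * w) %/ b)`_0 = - \sum_i w.[r i] / \prod_(j < l | j != i) (r j - r i).
Proof.
pose c i := w.[r i] / \prod_(j < l | j != i) (r j - r i).
have b_r i j : (b_ i).[r j] = if j == i then \prod_(k < l | k != i) (r k - r i) else 0.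
  rewrite /b_ horner_prod; case: eqVneq => [->|ne_ji].
    by apply: eq_bigr => k _; rewrite hornerD hornerC hornerN hornerX.
  by rewrite (bigD1 j) //= hornerD hornerC hornerN hornerX subrr mul0r.
(* By Lagrange interpolation the difference vanishes at every [r i], hence is divisible by [b]. *)
have [k wE] : exists k, w = k * b + \sum_i c i *: b_ i.
  suff /dvdpP[k kE] : b %| w - \sum_i c i *: b_ i by exists k; rewrite -kE subrK.
  have -> : b = (-1) ^+ l *: \prod_(z <- [seq r i | i <- enum 'I_l]) ('X - z%:P).
    rewrite big_map big_enum /= -mul_polyC rmorphXn rmorphN1 -[X in (-1) ^+ X]card_ord -prodrN.
    by apply: eq_bigr => i _; rewrite opprB.
  rewrite dvdpZl ?signr_eq0 //; apply: uniq_roots_dvdp; last first.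
    by rewrite uniq_rootsE map_inj_uniq ?enum_uniq.
  apply/allP => _ /mapP[i _ ->]; rewrite rootE hornerD hornerN horner_sum.
  rewrite (bigD1 i) //= hornerZ b_r eqxx [X in _ - (_ + X)]big1 => [|j /negPf ne_ji]; last first.
    by rewrite hornerZ b_r eq_sym ne_ji mulr0.
  rewrite addr0 divfK ?subrr //; apply/prodf_neq0 => j ne_ji.
  by rewrite subr_eq0 (inj_eq r_inj).
have b_Xb i : 'X * b_ i = r i *: b_ i - b.
  rewrite /b (bigD1 i) //= -/(b_ i) -mul_polyC; ring.
have -> : 'X * w = ('X * k - (\sum_i c i)%:P) * b + \sum_i (c i * r i) *: b_ i.
  rewrite wE mulrDr mulr_sumr.
  under eq_bigr => i _ do rewrite -scalerAr b_Xb scalerBr scalerA.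
  rewrite sumrB -scaler_suml -mul_polyC; ring.
rewrite divp_addl_mul_small ?coefB ?coefXM ?coefC /= ?sub0r // size_b.
rewrite (leq_ltn_trans (size_sum _ _ _)) // ltnS; apply/bigmax_leqP => i _.
by rewrite (leq_trans (size_scale_leq _ _)) // -ltnS -size_b.
Qed.

End PartialFractions.

(** * Content polynomials and Stirling numbers *)

Section ContentSum.

Variables (F : fieldType) (la : seq nat).

Notation l := (size la).
Notation lam i := (nth 0%N la i).

(** Along a row, the factors at [q + 1] are those at [q] moved by one column, so only the two end
    factors survive. *)
Lemma content_poly_telescope (q : {poly F}) :
  (content_poly F la \Po (q + 1)) * \prod_(i < l) (q - i%:R)
    = (content_poly F la \Po q) * \prod_(i < l) (q + (lam i)%:R - i%:R).
Proof.
rewrite /content_poly !rmorph_prod -!big_split /=; apply: eq_bigr => i _.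
rewrite !rmorph_prod /=.
under eq_bigr => j _ do rewrite comp_polyD comp_polyX comp_polyC rmorphB !rmorph_nat /=.
under [in RHS]eq_bigr => j _ do rewrite comp_polyD comp_polyX comp_polyC rmorphB !rmorph_nat /=.
elim: (lam i) => [|m IHm]; first by rewrite !big_ord0 addr0.
rewrite !big_ord_recr /= mulrAC IHm -[m.+1]addn1 natrD; ring.
Qed.

(** This lets the sum start at 2. Each cell contributes a quotient of quadratics whose numerator and
    denominator differ by the constant [- x]. *)
Lemma coef_desc_ratio1 x : coef_desc (ratio_num la x) (ratio_den la x) 1 = 0 :> F.
Proof.
(* [close P Q] expresses [P / Q = 1 + O(y^-2)], a property stable under products. *)
pose close (P Q : {poly F}) := [/\ (0 < size Q)%N, (size P <= size Q)%N
    & (size ((P - Q) * 'X)%R < size Q)%N].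
have closeM P Q P' Q' : close P Q -> close P' Q' -> close (P * P') (Q * Q').
  move=> [Q0 sPQ sXPQ] [Q'0 sPQ' sXPQ'].
  have sQQ' : size (Q * Q') = (size Q + size Q').-1 by rewrite size_mul -?size_poly_gt0.
  split; rewrite sQQ'; first by lia.
    by apply: leq_trans (size_polyMleq _ _) _; lia.
  have -> : (P * P' - Q * Q') * 'X = (P - Q) * 'X * P' + Q * ((P' - Q') * 'X) by ring.
  apply: leq_ltn_trans (size_polyD _ _) _; rewrite gtn_max; apply/andP; split.
    by apply: leq_ltn_trans (size_polyMleq _ _) _; lia.
  by apply: leq_ltn_trans (size_polyMleq _ _) _; lia.
have [D0 _ sXND] : close (ratio_num la x) (ratio_den la x).
  rewrite /ratio_num /ratio_den /content_poly !rmorph_prod -!big_split /=.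
  have close1 : close 1 1 by rewrite /close subrr mul0r size_poly0 size_poly1.
  apply: (big_ind2 close) => // i _; rewrite !rmorph_prod -!big_split /=.
  apply: (big_ind2 close) => // j _; rewrite !comp_polyD !comp_polyX !comp_polyC.
  set c := (_ - _)%:P.
  have sizeE (y z : F) : size ((y%:P - 'X) * (z%:P - 'X)) = 3.
    have s2 (u : F) : size (u%:P - 'X) = 2 by rewrite -opprB size_polyN size_XsubC.
    by rewrite size_mul ?s2 // -size_poly_gt0 s2.
  have E1 : (x%:P - 'X + 1 + c) * (- 'X + c)
      = ((x + 1 + (j%:R - i%:R))%:P - 'X) * ((j%:R - i%:R)%:P - 'X).
    by rewrite !rmorphD /=; ring.
  have E2 : (x%:P - 'X + c) * (- 'X + 1 + c)
      = ((x + (j%:R - i%:R))%:P - 'X) * ((1 + (j%:R - i%:R))%:P - 'X).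
    by rewrite !rmorphD /=; ring.
  have E3 : (x%:P - 'X + 1 + c) * (- 'X + c) - (x%:P - 'X + c) * (- 'X + 1 + c) = (- x)%:P.
    by rewrite rmorphN /=; ring.
  rewrite /close E3 E1 E2 !sizeE; split=> //.
  by rewrite mul_polyC (leq_ltn_trans (size_scale_leq _ _)) ?size_polyX.
rewrite /coef_desc expr1.
have -> : ratio_num la x * 'X
    = 'X * ratio_den la x + (ratio_num la x - ratio_den la x) * 'X by ring.
by rewrite divp_addl_mul_small // coefX.
Qed.

(** The Stirling numbers are the coefficients of the falling factorial, and the polynomial part of a
    quotient is linear in the numerator. *)
Lemma sum_stirling_coef_desc m (P Q : {poly F}) :
  \sum_(i < m.+1) (stirling1 m i)%:~R * coef_desc P Q i
    = ((P * \prod_(k < m) ('X - k%:R)) %/ Q)`_0.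
Proof.
have -> : \prod_(k < m) ('X - k%:R) = \sum_(i < m.+1) (stirling1 m i)%:~R *: 'X^i :> {poly F}.
  have -> : \prod_(k < m) ('X - k%:R) = map_poly intr (\prod_(k < m) ('X - (k%:R : int)%:P)) :> {poly F}.
    rewrite rmorph_prod; apply: eq_bigr => k _.
    by rewrite rmorphB /= map_polyX map_polyC /= [(k%:R)%:~R]rmorph_nat polyC_natr.
  rewrite -[LHS](coefK) poly_def size_map_poly_id0; last first.
    by rewrite (monicP (monic_prod_XsubC _ _ _)) rmorph1 oner_neq0.
  have -> : size (\prod_(k < m) ('X - (k%:R : int)%:P)) = m.+1.
    by rewrite size_prod_XsubC /index_enum -enumT size_enum_ord.
  by apply: eq_bigr => i _; rewrite coef_map.
rewrite mulr_sumr (big_morph (fun P => P %/ Q) (id1 := 0) (op1 := +%R)) ?div0p //; last first.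
  by move=> A B; rewrite divpD.
rewrite coef_sum; apply: eq_bigr => i _.
by rewrite -scalerAr divpZl coefZ.
Qed.

(** Up to [(-1) ^+ l], both sides are the product of the consecutive factors from [X - p] to
    [X + l - 1], split after the first [p] on the left and after the first [l] on the right. *)
Lemma shifted_prod_swap p :
  \prod_(i < l) (- 'X - i%:R) * \prod_(k < p) ('X - k.+1%:R)
    = \prod_(i < l) (p%:R - 'X - i%:R) * \prod_(k < p) ('X + l%:R - k.+1%:R) :> {poly F}.
Proof.
pose q m : {poly F} := 'X - p%:R + m%:R.
transitivity ((-1) ^+ l * \prod_(m < p + l) q m).
  rewrite big_split_ord /= [LHS]mulrC [RHS]mulrCA; congr (_ * _).
    rewrite (reindex_inj rev_ord_inj) /=; apply: eq_bigr => k _.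
    by rewrite /q /= subnSK // natrB 1?ltnW //; ring.
  rewrite -[X in (-1) ^+ X]card_ord -prodrN; apply: eq_bigr => i _.
  by rewrite /q natrD; ring.
rewrite [in LHS]addnC big_split_ord /= mulrA; congr (_ * _).
  rewrite -[X in (-1) ^+ X]card_ord -prodrN; apply: eq_bigr => i _.
  by rewrite /q; ring.
rewrite (reindex_inj rev_ord_inj) /=; apply: eq_bigr => k _.
by rewrite /q natrD natrB //; ring.
Qed.

Notation g := (fun i : 'I_l => (lam i + (l - i.+1))%N).
Let r (i : 'I_l) : F := (lam i)%:R - i%:R.

Let gE i : (g i)%:R = r i + l%:R - 1.
Proof. by rewrite /r natrD natrB // -natr1; ring. Qed.

Lemma prod_falling (m p : nat) :
  \prod_(k < p) (m%:R - k%:R) = (m ^_ p)%:R :> F.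
Proof.
rewrite ffact_prod natr_prod; have [le_pm | lt_mp] := leqP p m.
  by apply: eq_bigr => k _; rewrite natrB // (leq_trans (ltnW (ltn_ord k))).
rewrite (bigD1 (Ordinal lt_mp)) //= subrr mul0r.
by rewrite [RHS](bigD1 (Ordinal lt_mp)) //= subnn mul0r.
Qed.

(** Telescoping leaves the denominator [b], whose roots [r i] are distinct in [F] by the injectivity
    hypothesis; partial fractions then give one term for each root. *)
Lemma sum_content_coef p : injective (fun i => (g i)%:R : F) -> p%:R != 0 :> F ->
  \sum_(2 <= i < p.+2) (stirling1 p.+1 i)%:~R * content_coef la (p%:R : F) i =
   \sum_i (g i ^_ p)%:R * \prod_(j < l | j != i)
     (((g j)%:R - (g i)%:R + p%:R) / ((g j)%:R - (g i)%:R)).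
Proof.
move=> g_inj p_neq0.
have r_inj : injective r by move=> i j eq_r; apply: g_inj; rewrite !gE eq_r.
have grB i j : (g j)%:R - (g i)%:R = r j - r i by rewrite !gE; ring.
pose N := ratio_num la (p%:R : F); pose D := ratio_den la (p%:R : F).
have D_neq0 : D != 0 by have [] := size_ratio la (p%:R : F).
(* The terms 0 and 1 can be added: [stirling1 p.+1 0] is 0, and so is the coefficient of index 1. *)
transitivity (- p%:R^-1 * \sum_(i < p.+2) (stirling1 p.+1 i)%:~R * coef_desc N D i).
  rewrite -(big_mkord xpredT (fun i => (stirling1 p.+1 i)%:~R * coef_desc N D i)).
  rewrite big_ltn // big_ltn // coef_desc_ratio1 mulr0 add0r.
  have -> : stirling1 p.+1 0 = 0.
    by rewrite /stirling1 big_ord_recl subr0 coefXM.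
  rewrite mul0r add0r mulr_sumr; apply: eq_bigr => i _.
  by rewrite /content_coef mulrCA.
rewrite sum_stirling_coef_desc big_ord_recl subr0.
pose b : {poly F} := \prod_i ((r i)%:P - 'X).
pose d : {poly F} := \prod_i (p%:R - 'X + (r i)%:P).
pose Q1 : {poly F} := \prod_(k < p) ('X - k.+1%:R).
pose U : {poly F} := \prod_(k < p) ('X + l%:R - k.+1%:R).
pose a : {poly F} := \prod_(i < l) (p%:R - 'X - i%:R).
have size_cX (c : F) : size (c%:P - 'X) = 2 by rewrite -opprB size_polyN size_XsubC.
have b_neq0 : b != 0 by apply/prodf_neq0 => i _; rewrite -size_poly_gt0 size_cX.
have a_neq0 : a != 0.
  apply/prodf_neq0 => i _; have -> : p%:R - 'X - i%:R = (p%:R - i%:R)%:P - 'X :> {poly F}.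
    by rewrite rmorphB !rmorph_nat; ring.
  by rewrite -size_poly_gt0 size_cX.
have NQ1b : N * Q1 * b = D * (d * U).
  (* The factor [a] is what telescoping at [p - y] requires; telescoping at [- y] leaves a product
     that [swap] trades back for [a]. *)
  apply: (mulfI a_neq0).
  have T1 := content_poly_telescope (p%:R - 'X : {poly F}).
  have T2 := content_poly_telescope (- 'X : {poly F}).
  have swap := shifted_prod_swap p.
  have dE : d = \prod_(i < l) (p%:R - 'X + (lam i)%:R - i%:R).
    by apply: eq_bigr => i _; rewrite /r rmorphB !rmorph_nat addrA.
  have bE : b = \prod_(i < l) (- 'X + (lam i)%:R - i%:R).
    by apply: eq_bigr => i _; rewrite /r rmorphB !rmorph_nat; ring.
  rewrite -/a -dE in T1; rewrite -bE in T2; rewrite -/Q1 -/a -/U in swap.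
  rewrite /N /D /ratio_num /ratio_den polyC_natr.
  move: T1 T2 swap; set e := \prod_(i < l) (- 'X - i%:R).
  set C1 := _ \Po (_ - _ + 1); set C0 := _ \Po (p%:R - 'X).
  set C3 := _ \Po (- 'X + 1); set C2 := _ \Po (- 'X).
  move=> T1 T2 swap.
  transitivity (C1 * a * (C2 * b) * Q1); first by ring.
  rewrite T1 -T2; transitivity (C0 * d * C3 * (e * Q1)); first by ring.
  by rewrite swap; ring.
have -> : (N * ('X * \prod_(k < p) ('X - (lift ord0 k)%:R))) %/ D = ('X * (d * U)) %/ b.
  (* Both quotients are brought to the common denominator [D * b]. *)
  rewrite -[LHS](divp_pmul2r _ b_neq0 D_neq0) -[RHS](divp_pmul2r _ D_neq0 b_neq0).
  rewrite [b * D]mulrC; congr (_ %/ _).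
  transitivity ('X * (N * Q1 * b)); last by rewrite NQ1b; ring.
  by rewrite /Q1; ring.
rewrite coef0_divp_split // mulrNN mulr_sumr; apply: eq_bigr => i _.
rewrite prodf_div [X in _ = _ * (X / _)](eq_bigr (fun j => r j - r i + p%:R)) => [|j _];
  last by rewrite -grB.
rewrite [X in _ = _ * (_ / X)](eq_bigr (fun j => r j - r i)) => [|j _]; last by rewrite -grB.
(* The factor of [d] at [j = i] is [p], which cancels [p^-1]; as [g i = r i + l - 1], [U] takes the
   value [g i ^_ p]. *)
have -> : (d * U).[r i] = p%:R * (\prod_(j < l | j != i) (r j - r i + p%:R) * (g i ^_ p)%:R).
  rewrite hornerM mulrA; congr (_ * _).
    rewrite horner_prod (bigD1 i) //=; congr (_ * _).
      by rewrite -polyC_natr !(hornerD, hornerN, hornerX, hornerC); ring.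
    apply: eq_bigr => j _.
    by rewrite -polyC_natr !(hornerD, hornerN, hornerX, hornerC); ring.
  rewrite horner_prod -prod_falling; apply: eq_bigr => k _.
  rewrite -!polyC_natr !(hornerD, hornerN, hornerX, hornerC) gE -natr1; ring.
by rewrite !mulrA mulVf // mul1r; congr (_ / _); rewrite mulrC.
Qed.

End ContentSum.

Unset Implicit Arguments.

Theorem theorem4 (n p : nat) (la : seq nat) (s : 'S_n) :
  is_partition_of n la ->
  (1 <= p <= n)%N ->
  has_cycle_type s (p :: nseq (n - p) 1%N) ->
  (n ^_ p)%:R * normalized_sym_char la s =
    \sum_(2 <= i < p.+2) (stirling1 p.+1 i)%:~R * content_coef la (p%:R : algC) i.
Proof.
move=> la_part /andP[p_gt0 le_pn] type_s.
have g_inj := shifted_part_inj la_part.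
have la_gt0 : (0 < size la)%N.
  case: la la_part {g_inj} => // /and3P[_ _ /eqP n0].
  by rewrite -n0 leqNgt p_gt0 in le_pn.
rewrite (normalized_sym_charE la_part) (cycle_ratio (sum_shifted_part la_part)) //.
rewrite sum_content_coef ?pnatr_eq0 -?lt0n //.
by move=> i j /eqP; rewrite eqr_nat => /eqP/g_inj.
Qed.
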